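(* There is an absolute constant $C>0$ such that for every finite set $\Sigma$, every $n\ge1$, every $\mathbb{X}\subseteq\Sigma^n$, all $|\mathbb{X}|\times|\mathbb{X}|$ Gram matrices $\rho,\sigma$ of unit vectors, and every $\varepsilon\in(0,1)$, $$Q^{\mathrm{ct}}_\varepsilon(\rho,\sigma)\;\le\;C\,\frac{\mathrm{Adv}^\star(\rho,\sigma)}{\varepsilon},$$ i.e. $Q^{\mathrm{ct}}_\varepsilon(\rho,\sigma)=O(\mathrm{Adv}^\star(\rho,\sigma)/\varepsilon)$, where the continuous-time query model uses the oracle $h(y)=|y^-\rangle\langle y^-|$.
   Context: Notation: $(A\circ B)_{ij}=A_{ij}B_{ij}$, $\|A\|$ is the operator norm. Adversary bound: for $j\in[n]$ let $\Delta_j$ be the $|\mathbb{X}|\times|\mathbb{X}|$ matrix with $(\Delta_j)_{x,y}=1-\delta_{x_j,y_j}$. $\mathrm{Adv}^\star(\rho,\sigma)=\max_{\Gamma}\|\Gamma\circ(\rho-\sigma)\|$ over Hermitian $|\mathbb{X}|\times|\mathbb{X}|$ matrices $\Gamma$ with $\|\Gamma\circ\Delta_j\|\le 1$ for all $j\in[n]$. Oracle: let $\bar0$ be a symbol not in $\Sigma$, $\mathbb{C}^{\Sigma\cup\{\bar0\}}$ with orthonormal basis $\{|y\rangle\}$, and $|y^\pm\rangle=\frac1{\sqrt2}(|\bar0\rangle\pm|y\rangle)$ for $y\in\Sigma$. Take $h(y)=|y^-\rangle\langle y^-|$, and $H_{\mathcal Q}(x)=\sum_{j=1}^n|j\rangle\langle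 j|\otimes h(x_j)$ on $\mathbb{C}^n\otimes\mathbb{C}^{\Sigma\cup\{\bar 0\}}$. Continuous-time query model: an algorithm of duration $T$ acts on a finite-dimensional Hilbert space $\mathcal{H}=(\mathbb{C}^n\otimes\mathbb{C}^{\Sigma\cup\{\bar0\}}\otimes\mathbb{C}^w)\oplus\mathcal{H}'$ via $H_x(t)=H_{\mathcal D}(t)+\alpha(t)\,\widetilde H_{\mathcal Q}(x)$, $t\in[0,T]$, where $\widetilde H_{\mathcal Q}(x)$ acts as $H_{\mathcal Q}(x)\otimes I$ on the first summand and $0$ on $\mathcal H'$, $H_{\mathcal D}(t)$ is an input-independent Hermitian operator (piecewise continuous in $t$), and $\alpha:[0,T]\to\mathbb{R}$ with $|\alpha(t)|\le1$. $\mathcal U_x$ denotes the unitary generated at time $T$. With unit vectors $|\rho_x\rangle,|\sigma_x\rangle$ of Gram matrices $\rho,\sigma$ and a fixed workspace state $|0\rangle$, the algorithm converts $\rho$ to $\sigma$ with error at most $\varepsilon$ if $\mathrm{Re}\langle\sigma_x,0|\mathcal U_x|\rho_x,0\rangle\ge\sqrt{1-\varepsilon}$ for all $x\in\mathbb{X}$; $Q^{\mathrm{ct}}_\varepsilon(\rho,\sigma)$ is the infimum of $T$ over such algorithms (with $T=0$ allowed). *)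

(* Defs.v *)
From Stdlib Require Import Reals.
From HB Require Import structures.
From mathcomp Require Import all_boot.
Set Implicit Arguments.
Unset Strict Implicit.
Unset Printing Implicit Defensive.
Open Scope R_scope.

Definition Cx := (R * R)%type.
Definition C0 : Cx := (0, 0).
Definition C1 : Cx := (1, 0).
Definition Cadd (a b : Cx) : Cx := (fst a + fst b, snd a + snd b).
Definition Copp (a : Cx) : Cx := (- fst a, - snd a).
Definition Csub (a b : Cx) : Cx := Cadd a (Copp b).
Definition Cmul (a b : Cx) : Cx :=
  (fst a * fst b - snd a * snd b, fst a * snd b + snd a * fst b).
Definition Cconj (a : Cx) : Cx := (fst a, - snd a).
Definition Cscal (r : R) (a : Cx) : Cx := (r * fst a, r * snd a).
Definition Cnorm2 (a : Cx) : R := fst a * fst a + snd a * snd a.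
Definition Ci : Cx := (0, 1).

Definition vec (I : finType) := I -> Cx.
Definition mat (I : finType) := I -> I -> Cx.

Definition csum (I : finType) (F : I -> Cx) : Cx := \big[Cadd/C0]_(i : I) F i.
Definition rsum (I : finType) (F : I -> R) : R := \big[Rplus/0]_(i : I) F i.

Definition vnorm (I : finType) (v : vec I) : R := sqrt (rsum (fun i => Cnorm2 (v i))).
Definition inner (I : finType) (u v : vec I) : Cx :=
  csum (fun i => Cmul (Cconj (u i)) (v i)).
Definition mulmv (I : finType) (A : mat I) (v : vec I) : vec I :=
  fun i => csum (fun j => Cmul (A i j) (v j)).
Definition mulmm (I : finType) (A B : mat I) : mat I :=
  fun i k => csum (fun j => Cmul (A i j) (B j k)).
Definition idmat (I : finType) : mat I := fun i j => if i == j then C1 else C0.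
Definition hadamard (I : finType) (A B : mat I) : mat I := fun i j => Cmul (A i j) (B i j).
Definition msub (I : finType) (A B : mat I) : mat I := fun i j => Csub (A i j) (B i j).
Definition hermitian (I : finType) (A : mat I) : Prop := forall i j, A j i = Cconj (A i j).

Definition is_opnorm (I : finType) (A : mat I) (r : R) : Prop :=
  is_lub (fun s => exists v : vec I, vnorm v = 1 /\ s = vnorm (mulmv A v)) r.
Definition opnorm_le (I : finType) (A : mat I) (c : R) : Prop :=
  forall v : vec I, vnorm (mulmv A v) <= c * vnorm v.

Definition unit_gram (I : finType) (rho : mat I) : Prop :=
  exists (m : nat) (v : I -> vec 'I_m),
    (forall x, vnorm (v x) = 1) /\ (forall x y, rho x y = inner (v x) (v y)).

Definition Xidx (S : finType) (n : nat) (X : {set n.-tuple S}) : finType :=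
  {x : n.-tuple S | x \in X}.

Definition Delta (S : finType) (n : nat) (X : {set n.-tuple S}) (j : 'I_n)
  : mat (Xidx X) :=
  fun x y => if tnth (val x) j == tnth (val y) j then C0 else C1.

Definition adv_feasible (S : finType) (n : nat) (X : {set n.-tuple S})
  (G : mat (Xidx X)) : Prop :=
  hermitian G /\ forall j : 'I_n, opnorm_le (hadamard G (@Delta _ _ X j)) 1.
Definition adv_values (S : finType) (n : nat) (X : {set n.-tuple S})
  (rho sigma : mat (Xidx X)) (r : R) : Prop :=
  exists G, adv_feasible G /\ is_opnorm (hadamard G (msub rho sigma)) r.
Definition is_Adv (S : finType) (n : nat) (X : {set n.-tuple S})
  (rho sigma : mat (Xidx X)) (a : R) : Prop :=
  is_lub (adv_values rho sigma) a.

(* ---------- the algorithm's Hilbert space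
   H = (C^n ⊗ C^{Σ ∪ {0bar}} ⊗ C^w) ⊕ H',  dim H' = d;
   0bar is represented by None : option Σ ---------- *)
Definition Idx (S : finType) (n w d : nat) : finType :=
  ((('I_n * option S) * 'I_w) + 'I_d)%type.

(* coordinates of |y^-> = (|0bar> - |y>)/sqrt 2 *)
Definition ycoef (S : finType) (y : S) (a : option S) : R :=
  match a with
  | None => / sqrt 2
  | Some z => if z == y then - / sqrt 2 else 0
  end.
Definition hmat (S : finType) (y : S) (a b : option S) : Cx :=
  (ycoef y a * ycoef y b, 0).
(* tilde H_Q(x) = (sum_j |j><j| ⊗ h(x_j)) ⊗ I_w  ⊕ 0_{H'} *)
Definition HQ (S : finType) (n w d : nat) (x : n.-tuple S) : mat (Idx S n w d) :=
  fun p q =>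
    match p, q with
    | inl ((j, a), k), inl ((j', b), k') =>
        if (j == j') && (k == k') then hmat (tnth x j) a b else C0
    | _, _ => C0
    end.

Definition Hx (S : finType) (n w d : nat) (HD : R -> mat (Idx S n w d))
  (alpha : R -> R) (x : n.-tuple S) (t : R) : mat (Idx S n w d) :=
  fun p q => Cadd (HD t p q) (Cscal (alpha t) (@HQ S n w d x p q)).

(* f is piecewise continuous on [a,b]: finitely many breakpoints, and on each
   open piece f agrees with a continuous function (so one-sided limits exist) *)
Definition pw_cont (f : R -> R) (a b : R) : Prop :=
  exists (k : nat) (pts : nat -> R),
    pts 0%nat = a /\ pts k = b /\
    (forall i, (i < k)%nat -> pts i < pts i.+1) /\
    (forall i, (i < k)%nat -> exists g : R -> R, continuity g /\
        forall t, pts i < t < pts i.+1 -> f t = g t).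

Definition generated (I : finType) (H : R -> mat I) (T : R) (U : R -> mat I) : Prop :=
  U 0 = @idmat I /\
  (forall t, 0 <= t <= T -> forall p q,
      limit1_in (fun s => fst (U s p q)) (fun s => 0 <= s <= T) (fst (U t p q)) t /\
      limit1_in (fun s => snd (U s p q)) (fun s => 0 <= s <= T) (snd (U t p q)) t) /\
  (exists bad : list R, forall t, 0 < t < T -> ~ List.In t bad -> forall p q,
      derivable_pt_lim (fun s => fst (U s p q)) t
        (fst (Cmul (Copp Ci) (mulmm (H t) (U t) p q))) /\
      derivable_pt_lim (fun s => snd (U s p q)) t
        (snd (Cmul (Copp Ci) (mulmm (H t) (U t) p q)))).

Definition ct_converts (S : finType) (n : nat) (X : {set n.-tuple S})
  (rho sigma : mat (Xidx X)) (eps T : R) : Prop :=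
  exists (w d : nat) (HD : R -> mat (Idx S n w d)) (alpha : R -> R)
         (U : Xidx X -> R -> mat (Idx S n w d))
         (psi phi : Xidx X -> vec (Idx S n w d)),
    0 <= T /\
    (forall t, 0 <= t <= T -> hermitian (HD t)) /\
    (forall p q, pw_cont (fun t => fst (HD t p q)) 0 T /\
                 pw_cont (fun t => snd (HD t p q)) 0 T) /\
    (forall t, 0 <= t <= T -> Rabs (alpha t) <= 1) /\
    (forall x : Xidx X, generated (Hx HD alpha (val x)) T (U x)) /\
    (forall x y, inner (psi x) (psi y) = rho x y /\ inner (phi x) (phi y) = sigma x y) /\
    (forall x, sqrt (1 - eps) <= fst (inner (phi x) (mulmv (U x T) (psi x)))).

(* Main.v *)
(** By semidefinite duality the adversary bound yields vectors [u_a], [v_a] whose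
    symmetrised products, restricted to the pairs differing in coordinate [j_a],
    sum to [rho - sigma] and whose total squared lengths are at most [adv + delta].
    Duality is obtained by separating [(rho - sigma, adv)] from the cone of all
    pairs (matrix, weights) so generated; approximate separation is enough, since
    its error can be absorbed into the weights.

    From [|x_j^+> v + mu |x_j^-> u] one builds a catalyst whose Gram matrix a query of
    duration [tau] changes by exactly [(sigma - rho) / N].  Hence after each query the
    state [sqrt (1 - k/N) rho_x + sqrt (k/N) sigma_x + catalyst] has the Gram matrix of
    the next one, and an input-independent reflection, implemented with [alpha = 0] in
    an arbitrarily short time, maps one to the other.  After [N] rounds [rho_x] plus
    catalyst has become [sigma_x] plus catalyst exactly, so that omitting the catalyst,
    whose squared norm is [O(adv / (N tau))], costs an error of that order. *)

From Stdlib Require Import Reals Lra.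
From Stdlib Require Import FunctionalExtensionality Classical.
From HB Require Import structures.
From mathcomp Require Import all_boot.
Require Import Defs.
Set Implicit Arguments.
Unset Strict Implicit.
Unset Printing Implicit Defensive.
Open Scope R_scope.

(** * Finite sums of real and complex numbers *)

Fact Rplus_assoc_law : associative Rplus.
Proof. by move=> a b c; rewrite Rplus_assoc. Qed.

HB.instance Definition _ :=
  Monoid.isComLaw.Build R 0 Rplus Rplus_assoc_law Rplus_comm Rplus_0_l.

Lemma Cx_eq (a b : Cx) : fst a = fst b -> snd a = snd b -> a = b.
Proof. by case: a => ? ?; case: b => ? ? /= -> ->. Qed.

Ltac cx := apply: Cx_eq; rewrite /Cadd /Csub /Cadd /Copp /Cmul /Cconj /Cscal
  /Cnorm2 /C0 /C1 /Ci /=; try ring; try field; try lra.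

Lemma Cx_ring : ring_theory C0 C1 Cadd Cmul Csub Copp (@eq Cx).
Proof. by split; intros; cx. Qed.

Add Ring CxRing : Cx_ring.

Fact CaddA : associative Cadd. Proof. by move=> a b c; ring. Qed.
Fact CaddC : commutative Cadd. Proof. by move=> a b; ring. Qed.
Fact Cadd0 : left_id C0 Cadd. Proof. by move=> a; ring. Qed.

HB.instance Definition _ := Monoid.isComLaw.Build Cx C0 Cadd CaddA CaddC Cadd0.

Lemma ConjD a b : Cconj (Cadd a b) = Cadd (Cconj a) (Cconj b). Proof. by cx. Qed.
Lemma ConjM a b : Cconj (Cmul a b) = Cmul (Cconj a) (Cconj b). Proof. by cx. Qed.
Lemma ConjK a : Cconj (Cconj a) = a. Proof. by cx. Qed.
Lemma ConjB a b : Cconj (Csub a b) = Csub (Cconj a) (Cconj b). Proof. by cx. Qed.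
Lemma Conj0 : Cconj C0 = C0. Proof. by cx. Qed.
Lemma Conj1 : Cconj C1 = C1. Proof. by cx. Qed.
Lemma Conj_real r : Cconj (r, 0) = (r, 0). Proof. by cx. Qed.
Lemma CscalE r a : Cscal r a = Cmul (r, 0) a. Proof. by cx. Qed.
Lemma Cconj_mulE a : Cmul (Cconj a) a = (Cnorm2 a, 0). Proof. by cx. Qed.
Lemma Cnorm2_ge0 a : 0 <= Cnorm2 a. Proof. by rewrite /Cnorm2; nra. Qed.
Lemma Cnorm2M a b : Cnorm2 (Cmul a b) = Cnorm2 a * Cnorm2 b.
Proof. by rewrite /Cnorm2 /=; ring. Qed.
Lemma Cnorm2_scal r a : Cnorm2 (Cscal r a) = r * r * Cnorm2 a.
Proof. by rewrite /Cnorm2 /=; ring. Qed.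
Lemma Cnorm2_conj a : Cnorm2 (Cconj a) = Cnorm2 a.
Proof. by rewrite /Cnorm2 /=; ring. Qed.

Definition cardR (I : finType) : R := INR #|I|.

Section Sums.
Variable I : finType.
Implicit Types (F G : I -> R) (P Q : I -> Cx).

Lemma eq_rsum F G : (forall i, F i = G i) -> rsum F = rsum G.
Proof. by move=> h; apply: eq_bigr => i _; exact: h. Qed.

Lemma rsumD F G : rsum (fun i => F i + G i) = rsum F + rsum G.
Proof. by rewrite /rsum big_split. Qed.

Lemma rsumZ c F : rsum (fun i => c * F i) = c * rsum F.
Proof.
rewrite /rsum; apply: (big_ind2 (fun a b => a = c * b)) => //; first by ring.
by move=> ? ? ? ? -> ->; ring.
Qed.

Lemma rsum_le F G : (forall i, F i <= G i) -> rsum F <= rsum G.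
Proof. by move=> h; apply: (big_ind2 Rle) => // *; lra. Qed.

Lemma rsum_eq0 F : (forall i, F i = 0) -> rsum F = 0.
Proof. by move=> h; rewrite /rsum big1. Qed.

Lemma rsum_ge0 F : (forall i, 0 <= F i) -> 0 <= rsum F.
Proof. by move=> h; rewrite -(@rsum_eq0 (fun=> 0)) //; exact: rsum_le. Qed.

Lemma rsum_const (c : R) : rsum (fun _ : I => c) = cardR I * c.
Proof.
rewrite /rsum /cardR big_const; elim: #|I| => [|k IH]; first by rewrite /=; ring.
by rewrite iterS IH S_INR; ring.
Qed.

Lemma rsum_delta k F : rsum (fun i => if i == k then F i else 0) = F k.
Proof. by rewrite /rsum -big_mkcond big_pred1_eq. Qed.

Lemma rsum_ge_term F k : (forall i, 0 <= F i) -> F k <= rsum F.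
Proof.
move=> h; rewrite -[F k](@rsum_delta k F); apply: rsum_le => i.
by case: eqP => _; [lra | exact: h].
Qed.

Lemma eq_csum P Q : (forall i, P i = Q i) -> csum P = csum Q.
Proof. by move=> h; apply: eq_bigr => i _; exact: h. Qed.

Lemma csumD P Q : csum (fun i => Cadd (P i) (Q i)) = Cadd (csum P) (csum Q).
Proof. by rewrite /csum big_split. Qed.

Lemma csumZ c P : csum (fun i => Cmul c (P i)) = Cmul c (csum P).
Proof.
rewrite /csum; apply: (big_ind2 (fun a b => a = Cmul c b)) => //; first by ring.
by move=> ? ? ? ? -> ->; ring.
Qed.

Lemma csumZr c P : csum (fun i => Cmul (P i) c) = Cmul (csum P) c.
Proof.
transitivity (Cmul c (csum P)); last by ring.
by rewrite -csumZ; apply: eq_csum => i; ring.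
Qed.

Lemma csum_conj P : Cconj (csum P) = csum (fun i => Cconj (P i)).
Proof.
rewrite /csum; apply: (big_ind2 (fun a b => Cconj a = b)) => //.
  by exact: Conj0.
by move=> ? ? ? ? <- <-; exact: ConjD.
Qed.

Lemma csum_eq0 P : (forall i, P i = C0) -> csum P = C0.
Proof. by move=> h; rewrite /csum big1. Qed.

Lemma csum_delta k P : csum (fun i => if i == k then P i else C0) = P k.
Proof. by rewrite /csum -big_mkcond big_pred1_eq. Qed.

Lemma fst_csum P : fst (csum P) = rsum (fun i => fst (P i)).
Proof. by rewrite /csum /rsum; apply: (big_morph (fun a : Cx => fst a)). Qed.

Lemma snd_csum P : snd (csum P) = rsum (fun i => snd (P i)).
Proof. by rewrite /csum /rsum; apply: (big_morph (fun a : Cx => snd a)). Qed.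

End Sums.

Lemma csum_exchange (I J : finType) (P : I -> J -> Cx) :
  csum (fun i => csum (fun j => P i j)) = csum (fun j => csum (fun i => P i j)).
Proof. by rewrite /csum exchange_big. Qed.

Lemma rsum_pair (I J : finType) (F : I * J -> R) :
  rsum F = rsum (fun i => rsum (fun j => F (i, j))).
Proof. by rewrite /rsum pair_bigA; apply: eq_bigr; case. Qed.

Lemma csum_pair (I J : finType) (F : I * J -> Cx) :
  csum F = csum (fun i => csum (fun j => F (i, j))).
Proof. by rewrite /csum pair_bigA; apply: eq_bigr; case. Qed.

Lemma rsum_sum (I J : finType) (F : I + J -> R) :
  rsum F = rsum (fun i => F (inl i)) + rsum (fun j => F (inr j)).
Proof. by rewrite /rsum big_sumType. Qed.

Lemma csum_sum (I J : finType) (F : I + J -> Cx) :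
  csum F = Cadd (csum (fun i => F (inl i))) (csum (fun j => F (inr j))).
Proof. by rewrite /csum big_sumType. Qed.

Lemma rsum_bool (F : bool -> R) : rsum F = F true + F false.
Proof. by rewrite /rsum big_bool. Qed.

Lemma csum_bool (F : bool -> Cx) : csum F = Cadd (F true) (F false).
Proof. by rewrite /csum big_bool. Qed.

Lemma csum_option (I : finType) (F : option I -> Cx) :
  csum F = Cadd (F None) (csum (fun i => F (Some i))).
Proof.
rewrite /csum (bigD1 None) //=; congr Cadd.
rewrite (reindex_omap (@Some I) id) /=; last by case.
by apply: eq_bigl => i; rewrite eqxx.
Qed.

Lemma csum_ord_enum (A : finType) (F : A -> Cx) :
  csum (fun k : 'I_#|A| => F (enum_val k)) = csum F.
Proof.
rewrite /csum [RHS](reindex (@enum_val A A)) //=; apply: onW_bij.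
exact: enum_val_bij.
Qed.

(** * Vectors and matrices *)

Section Vectors.
Variable I : finType.
Implicit Types (u v : vec I) (A B : mat I).

Definition vadd u v : vec I := fun i => Cadd (u i) (v i).
Definition vsub u v : vec I := fun i => Csub (u i) (v i).
Definition vscal c v : vec I := fun i => Cmul c (v i).
Definition norm2 v : R := rsum (fun i => Cnorm2 (v i)).

Lemma vnormE v : vnorm v = sqrt (norm2 v). Proof. by []. Qed.

Lemma norm2_ge0 v : 0 <= norm2 v.
Proof. by apply: rsum_ge0 => i; exact: Cnorm2_ge0. Qed.

Lemma vnorm_ge0 v : 0 <= vnorm v. Proof. exact: sqrt_pos. Qed.

Lemma vnorm_sqr v : vnorm v * vnorm v = norm2 v.
Proof. by rewrite sqrt_sqrt //; exact: norm2_ge0. Qed.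

Lemma innerDr u v w : inner u (vadd v w) = Cadd (inner u v) (inner u w).
Proof. by rewrite /inner -csumD; apply: eq_csum => i; rewrite /vadd; ring. Qed.

Lemma innerZr c u v : inner u (vscal c v) = Cmul c (inner u v).
Proof. by rewrite /inner -csumZ; apply: eq_csum => i; rewrite /vscal; ring. Qed.

Lemma inner_conj u v : inner v u = Cconj (inner u v).
Proof.
by rewrite /inner csum_conj; apply: eq_csum => i; rewrite ConjM ConjK; ring.
Qed.

Lemma innerDl u v w : inner (vadd v w) u = Cadd (inner v u) (inner w u).
Proof. by rewrite inner_conj innerDr ConjD -!inner_conj. Qed.

Lemma innerZl c u v : inner (vscal c u) v = Cmul (Cconj c) (inner u v).
Proof. by rewrite inner_conj innerZr ConjM -inner_conj. Qed.

Lemma vsubE u v : vsub u v = vadd u (vscal (Copp C1) v).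
Proof. by apply: functional_extensionality => i; rewrite /vsub /vadd /vscal; ring. Qed.

Lemma innerBr u v w : inner u (vsub v w) = Csub (inner u v) (inner u w).
Proof. by rewrite vsubE innerDr innerZr; ring. Qed.

Lemma innerBl u v w : inner (vsub v w) u = Csub (inner v u) (inner w u).
Proof. by rewrite inner_conj innerBr ConjB -!inner_conj. Qed.

Lemma inner_self v : inner v v = (norm2 v, 0).
Proof.
apply: Cx_eq; rewrite /= /inner ?fst_csum ?snd_csum.
  by apply: eq_rsum => i; rewrite Cconj_mulE.
by apply: rsum_eq0 => i; rewrite Cconj_mulE.
Qed.

Lemma norm2_eq0 v : norm2 v = 0 -> v = fun=> C0.
Proof.
move=> h; apply: functional_extensionality => i.
have := @rsum_ge_term I (fun i => Cnorm2 (v i)) i (fun i => Cnorm2_ge0 (v i)).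
rewrite -/(norm2 v) h /Cnorm2 => h'.
by apply: Cx_eq; rewrite /=; nra.
Qed.

Lemma norm2_scal c v : norm2 (vscal c v) = Cnorm2 c * norm2 v.
Proof. by rewrite /norm2 -rsumZ; apply: eq_rsum => i; rewrite Cnorm2M. Qed.

Lemma Re_inner_ge u v : - ((norm2 u + norm2 v) / 2) <= fst (inner u v).
Proof.
have := norm2_ge0 (vadd u v).
have -> : norm2 (vadd u v) = fst (inner (vadd u v) (vadd u v)) by rewrite inner_self.
rewrite innerDr !innerDl (inner_conj u v) !inner_self /=; lra.
Qed.

(** Cauchy-Schwarz for the real part: the squared norm of [u - s v] is a nonnegative quadratic in
    [s], tested at [s = vnorm u / vnorm v]. When [u] or [v] vanishes this choice is degenerate and
    another [s] makes the quadratic negative. *)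
Lemma Re_inner_le u v : fst (inner u v) <= vnorm u * vnorm v.
Proof.
have pos s : 0 <= norm2 u - 2 * s * fst (inner u v) + s * s * norm2 v.
  have := norm2_ge0 (vsub u (vscal (s, 0) v)).
  have -> : norm2 (vsub u (vscal (s, 0) v))
    = fst (inner (vsub u (vscal (s, 0) v)) (vsub u (vscal (s, 0) v))).
    by rewrite inner_self.
  rewrite innerBr !innerBl innerZr !innerZl innerZr (inner_conj u v) !inner_self /=; lra.
have hu := vnorm_ge0 u; have hv := vnorm_ge0 v.
move: pos; rewrite -!vnorm_sqr => pos.
have [v0|v0] : vnorm v = 0 \/ 0 < vnorm v by lra.
  rewrite v0 Rmult_0_r; apply: Rnot_lt_le => h.
  have := pos ((vnorm u * vnorm u + 1) / (2 * fst (inner u v))).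
  have -> : 2 * ((vnorm u * vnorm u + 1) / (2 * fst (inner u v))) * fst (inner u v)
    = vnorm u * vnorm u + 1 by field; lra.
  by rewrite v0; lra.
apply: Rnot_lt_le => h.
have := pos (vnorm u / vnorm v).
have -> : vnorm u / vnorm v * (vnorm u / vnorm v) * (vnorm v * vnorm v)
  = vnorm u * vnorm u by field; lra.
have -> : vnorm u * vnorm u - 2 * (vnorm u / vnorm v) * fst (inner u v) + vnorm u * vnorm u
  = 2 * (vnorm u / vnorm v) * (vnorm u * vnorm v - fst (inner u v)) by field; lra.
have [u0|u0] : vnorm u = 0 \/ 0 < vnorm u by lra.
  have := pos ((fst (inner u v)) / (vnorm v * vnorm v)).
  have -> : fst (inner u v) / (vnorm v * vnorm v)
    * (fst (inner u v) / (vnorm v * vnorm v)) * (vnorm v * vnorm v)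
    = fst (inner u v) * fst (inner u v) / (vnorm v * vnorm v).
    by field; lra.
  have -> : 2 * ((fst (inner u v)) / (vnorm v * vnorm v)) * fst (inner u v)
    = 2 * (fst (inner u v) * fst (inner u v) / (vnorm v * vnorm v)) by field; lra.
  have : 0 < fst (inner u v) * fst (inner u v) / (vnorm v * vnorm v).
    by apply: Rdiv_lt_0_compat; apply: Rmult_lt_0_compat; nra.
  by rewrite u0; lra.
have : 0 < vnorm u / vnorm v by exact: Rdiv_lt_0_compat.
by nra.
Qed.

Lemma mulmvD A u v : mulmv A (vadd u v) = vadd (mulmv A u) (mulmv A v).
Proof.
apply: functional_extensionality => i; rewrite /mulmv /vadd -csumD.
by apply: eq_csum => j; ring.
Qed.

Lemma mulmvZ A c v : mulmv A (vscal c v) = vscal c (mulmv A v).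
Proof.
apply: functional_extensionality => i; rewrite /mulmv /vscal -csumZ.
by apply: eq_csum => j; ring.
Qed.

Lemma mulmvB A u v : mulmv A (vsub u v) = vsub (mulmv A u) (mulmv A v).
Proof. by rewrite !vsubE mulmvD mulmvZ. Qed.

Lemma mulmvA A B v : mulmv (mulmm A B) v = mulmv A (mulmv B v).
Proof.
apply: functional_extensionality => i; rewrite /mulmv /mulmm.
transitivity (csum (fun j => csum (fun k => Cmul (Cmul (A i k) (B k j)) (v j)))).
  by apply: eq_csum => j; rewrite csumZr.
rewrite csum_exchange; apply: eq_csum => k; rewrite -csumZ.
by apply: eq_csum => j; ring.
Qed.

Lemma mulmv1 v : mulmv (@idmat I) v = v.
Proof.
apply: functional_extensionality => i; rewrite /mulmv /idmat -[RHS](csum_delta i v).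
by apply: eq_csum => j; rewrite eq_sym; case: eqP => _; ring.
Qed.

Lemma inner_hermitian A u v : hermitian A -> inner u (mulmv A v) = inner (mulmv A u) v.
Proof.
move=> hA; rewrite /inner /mulmv.
transitivity (csum (fun i => csum (fun j => Cmul (Cconj (u i)) (Cmul (A i j) (v j))))).
  by apply: eq_csum => i; rewrite csumZ.
rewrite csum_exchange; apply: eq_csum => j; rewrite csum_conj -csumZr.
by apply: eq_csum => i; rewrite (hA i j) !ConjM ConjK; ring.
Qed.

Definition delta (k : I) : vec I := fun i => if i == k then C1 else C0.

Lemma mulmv_delta A k : mulmv A (delta k) = fun i => A i k.
Proof.
apply: functional_extensionality => i.
rewrite /mulmv -[RHS](csum_delta k (A i)).
by apply: eq_csum => j; rewrite /delta; case: eqP => _; ring.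
Qed.

Lemma mat_eq A B : (forall v, mulmv A v = mulmv B v) -> A = B.
Proof.
move=> h; apply: functional_extensionality => i; apply: functional_extensionality => k.
by move: (h (delta k)); rewrite !mulmv_delta => /(f_equal (fun f => f i)).
Qed.

End Vectors.

(** * Approximate separation from a convex cone *)

Lemma inf_approx (Q : R -> Prop) (m : R) :
  (exists r, Q r) -> (forall r, Q r -> m <= r) ->
  exists m', [/\ m <= m', forall r, Q r -> m' <= r
    & forall z, 0 < z -> exists r, Q r /\ r < m' + z].
Proof.
move=> [r0 Qr0] lb.
have [||M [ub lub]] := completeness (fun r => Q (- r)).
- by exists (- m) => r /lb; lra.
- by exists (- r0); rewrite Ropp_involutive.
exists (- M); split.
- have : M <= - m by apply: lub => r /lb; lra.
  by lra.
- move=> r Qr; have : - r <= M by apply: ub; rewrite Ropp_involutive.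
  by lra.
- move=> z z0; apply: NNPP => h.
  have : M <= M - z; last by lra.
  apply: lub => r Qr; apply: Rnot_lt_le => lt.
  by apply: h; exists (- r); split => //; lra.
Qed.

Section Cone.
Variable I : finType.
Implicit Types p z g c : I -> R.

Definition rdot p z : R := rsum (fun i => p i * z i).

Lemma rdot_subscal g z s :
  rdot (fun i => g i - s * z i) (fun i => g i - s * z i)
  = rdot g g - 2 * s * rdot g z + s * s * rdot z z.
Proof.
have -> : rdot g g - 2 * s * rdot g z + s * s * rdot z z
  = rdot g g + (- 2 * s) * rdot g z + s * s * rdot z z by ring.
rewrite /rdot -!rsumZ -!rsumD; apply: eq_rsum => i; ring.
Qed.

Lemma rdot_ge0 z : 0 <= rdot z z.
Proof. by apply: rsum_ge0 => i; nra. Qed.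

Lemma rdot_bound z (w : I -> R) :
  (forall i, Rabs (z i) <= w i) -> rdot z z <= rsum w * rsum w.
Proof.
move=> h; have w0 i : 0 <= w i by apply: Rle_trans (h i); exact: Rabs_pos.
rewrite /rdot -rsumZ; apply: rsum_le => i.
have := rsum_ge_term i w0; have := h i; have := Rabs_pos (z i).
have -> : z i * z i = Rabs (z i) * Rabs (z i).
  by rewrite -Rabs_mult Rabs_pos_eq //; nra.
by move=> *; apply: Rmult_le_compat; lra.
Qed.

(* A near-minimiser [c] of the distance from [p] plays the role of the nearest
   point, so the cone need not be closed; the price is the error [eta * b]. *)
Lemma cone_separation (K : (I -> R) -> Prop) p m eta :
  (exists z, K z) ->
  (forall y z, K y -> K z -> K (fun i => y i + z i)) ->
  (forall s z, 0 <= s -> K z -> K (fun i => s * z i)) ->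
  0 < m -> 0 < eta ->
  (forall z, K z -> m <= rdot (fun i => p i - z i) (fun i => p i - z i)) ->
  exists c, [/\ K c, m / 2 <= rdot (fun i => p i - c i) p
    & forall z b, K z -> 0 <= b -> rdot z z <= b * b ->
      rdot (fun i => p i - c i) z <= eta * b].
Proof.
move=> [z0 Kz0] KD KZ m0 eta0 lb.
have [||m' [mm' lb' near]] := @inf_approx
  (fun r => exists2 z, K z & r = rdot (fun i => p i - z i) (fun i => p i - z i)) m.
- by exists (rdot (fun i => p i - z0 i) (fun i => p i - z0 i)); exists z0.
- by move=> r [z Kz ->]; exact: lb.
(* [Q] bounds the squared length of any near-minimiser. [s] is the fraction by which [c] is shrunk
   below, small enough that the second-order cost [s * s * Q] is only [s * m' / 2]. *)
pose Q := 2 * rdot p p + 2 * (m' + 1); pose s := m' / (2 * Q).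
have pp := rdot_ge0 p.
have Q0 : 0 < Q by rewrite /Q; lra.
have s0 : 0 < s by apply: Rdiv_lt_0_compat; lra.
have sQ : s * Q = m' / 2 by rewrite /s; field; lra.
have s1 : s <= 1.
  by apply: (Rmult_le_reg_r Q) => //; rewrite sQ Rmult_1_l /Q; lra.
clearbody s.
(* The tolerance of the near-minimiser serves three purposes: [1] bounds [c], [s * m' / 2] pays for
   shrinking [c], and [eta * eta] pays for moving along an arbitrary [z]. *)
pose ze := Rmin 1 (Rmin (s * m' / 2) (eta * eta)).
have ze0 : 0 < ze.
  by rewrite /ze; apply: Rmin_pos; [lra | apply: Rmin_pos; [|nra]; nra].
have ze1 : ze <= 1 by exact: Rmin_l.
have ze2 : ze <= s * m' / 2 by apply: Rle_trans (Rmin_l _ _); exact: Rmin_r.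
have ze3 : ze <= eta * eta by apply: Rle_trans (Rmin_r _ _); exact: Rmin_r.
have [_ [[c Kc ->] cmin]] := near _ ze0.
set g := fun i => p i - c i in cmin *.
(* Near-minimality as a variational inequality: no move inside the cone lowers the squared distance
   by more than [ze]. *)
have gap z a : K (fun i => c i + a * z i) ->
    2 * a * rdot g z <= ze + a * a * rdot z z.
  move=> Kz; have := lb' _ (ex_intro2 _ _ _ Kz erefl).
  have -> : (fun i => p i - (c i + a * z i)) = (fun i => g i - a * z i).
    by apply: functional_extensionality => i; rewrite /g; ring.
  by rewrite rdot_subscal; lra.
have gg : m' <= rdot g g by apply: lb'; exists c.
have gp : rdot g p = rdot g g + rdot g c.
  by rewrite /rdot -rsumD; apply: eq_rsum => i; rewrite /g; ring.
have cQ : rdot c c <= Q.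
  have : rdot c c <= 2 * rdot p p + 2 * rdot g g.
    rewrite /rdot -!rsumZ -rsumD; apply: rsum_le => i; rewrite /g.
    have := Rle_0_sqr (p i + (p i - c i)); rewrite /Rsqr.
    by have := Rle_0_sqr (p i - (p i - c i)); rewrite /Rsqr; lra.
  by rewrite /Q; lra.
exists c; split => //.
  (* Shrinking [c] stays in the cone and forces [rdot g c >= - m' / 2]. Since
     [rdot g p = rdot g g + rdot g c] with [rdot g g >= m'], half of the distance survives. *)
  have := gap c (- s).
  have -> : (fun i => c i + - s * c i) = (fun i => (1 - s) * c i).
    by apply: functional_extensionality => i; ring.
  have s1' : 0 <= 1 - s by lra.
  move=> /(_ (KZ _ _ s1' Kc)) h.
  have h2 : s * (s * rdot c c) <= s * (m' / 2).
    rewrite -sQ; apply: Rmult_le_compat_l; first lra.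
    by apply: Rmult_le_compat_l; lra.
  have : s * (- rdot g c) <= s * (m' / 2) by lra.
  move/(Rmult_le_reg_l _ _ _ s0); rewrite gp; lra.
move=> z b Kz b0 zb; rewrite -/g.
have gz a : 0 < a -> 2 * a * rdot g z <= eta * eta + a * a * (b * b).
  move=> a0; have a0' : 0 <= a by lra.
  have := gap _ a (KD _ _ Kc (KZ _ _ a0' Kz)).
  have : a * a * rdot z z <= a * a * (b * b).
    by apply: Rmult_le_compat_l => //; nra.
  lra.
have [b1|b1] : b = 0 \/ 0 < b by lra.
  rewrite b1 Rmult_0_r; apply: Rnot_lt_le => h.
  have ax : 0 < eta * eta / rdot g z by apply: Rdiv_lt_0_compat => //; nra.
  have := gz _ ax; rewrite b1.
  have -> : 2 * (eta * eta / rdot g z) * rdot g z = 2 * (eta * eta) by field; lra.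
  nra.
(* This step length balances the two error terms: [eta * eta] and [a * a * (b * b)] are then
   equal. *)
have ax : 0 < eta / b by exact: Rdiv_lt_0_compat.
have := gz _ ax.
have -> : eta / b * (eta / b) * (b * b) = eta / b * (eta * b) by field; lra.
have -> : eta * eta = eta / b * (eta * b) by field; lra.
move=> h; apply: (Rmult_le_reg_l (eta / b)) => //; lra.
Qed.

End Cone.

(** * The dual of the adversary bound *)

Section Duality.
Variables (X J : finType) (D : J -> X -> X -> bool).
Hypothesis Dsym : forall j x y, D j x y = D j y x.
Hypothesis Dirr : forall j x, D j x x = false.
Hypothesis Dsep : forall x y, x != y -> exists j, D j x y.

Definition dual_mat (A : finType) (jl : A -> J) (u v : A -> vec X) : mat X :=
  fun x y => csum (fun a => if D (jl a) x y
    then Cscal (1 / 2) (Cadd (Cmul (Cconj (u a x)) (v a y))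
                             (Cmul (Cconj (v a x)) (u a y))) else C0).

Definition dual_weight (A : finType) (u v : A -> vec X) (x : X) : R :=
  rsum (fun a => (Cnorm2 (u a x) + Cnorm2 (v a x)) / 2).

(** Real coordinates of a Hermitian matrix together with a weight vector, so that the separation
    takes place in a real Euclidean space. *)
Definition pack (M : mat X) (t : X -> R) (i : X * X * bool + X) : R :=
  match i with
  | inl (x, y, b) => if b then snd (M x y) else fst (M x y)
  | inr x => t x
  end.

Definition dual_cone (z : X * X * bool + X -> R) : Prop :=
  exists (A : finType) (jl : A -> J) (u v : A -> vec X),
    z = pack (dual_mat jl u v) (dual_weight u v).

Definition mdot (G M : mat X) : Cx :=
  csum (fun x => csum (fun y => Cmul (Cconj (G x y)) (M x y))).

Lemma rdot_pack G s M t :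
  rdot (pack G s) (pack M t) = fst (mdot G M) + rsum (fun x => s x * t x).
Proof.
rewrite /rdot rsum_sum; congr Rplus.
rewrite !rsum_pair /mdot fst_csum; apply: eq_rsum => x; rewrite fst_csum.
by apply: eq_rsum => y; rewrite rsum_bool /=; ring.
Qed.

Lemma rsum_pack M t : rsum (pack M t)
  = rsum (fun x => rsum (fun y => fst (M x y) + snd (M x y))) + rsum t.
Proof.
rewrite rsum_sum; congr Rplus.
by rewrite !rsum_pair; apply: eq_rsum => x; apply: eq_rsum => y; rewrite rsum_bool /=; ring.
Qed.

Lemma dual_matD (A B : finType) (j : A -> J) (k : B -> J) u v u' v' x y :
  dual_mat (fun c => match c with inl a => j a | inr b => k b end)
    (fun c => match c with inl a => u a | inr b => u' b end)
    (fun c => match c with inl a => v a | inr b => v' b end) x y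
  = Cadd (dual_mat j u v x y) (dual_mat k u' v' x y).
Proof. by rewrite /dual_mat csum_sum. Qed.

Lemma dual_weightD (A B : finType) (u v : A -> vec X) (u' v' : B -> vec X) x :
  dual_weight (fun c => match c with inl a => u a | inr b => u' b end)
    (fun c => match c with inl a => v a | inr b => v' b end) x
  = dual_weight u v x + dual_weight u' v' x.
Proof. by rewrite /dual_weight rsum_sum. Qed.

Lemma dual_cone_add y z :
  dual_cone y -> dual_cone z -> dual_cone (fun i => y i + z i).
Proof.
move=> [A [j [u [v ->]]]] [B [k [u' [v' ->]]]].
exists (A + B)%type, (fun c => match c with inl a => j a | inr b => k b end),
  (fun c => match c with inl a => u a | inr b => u' b end),
  (fun c => match c with inl a => v a | inr b => v' b end).
apply: functional_extensionality => -[[[x y'] b]|x] /=.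
  by case: b; rewrite dual_matD.
by rewrite dual_weightD.
Qed.

Lemma dual_cone_scal s z : 0 <= s -> dual_cone z -> dual_cone (fun i => s * z i).
Proof.
move=> s0 [A [j [u [v ->]]]].
have ss := sqrt_sqrt _ s0.
exists A, j, (fun a => vscal (sqrt s, 0) (u a)), (fun a => vscal (sqrt s, 0) (v a)).
apply: functional_extensionality => -[[[x y] b]|x] /=.
  have -> : dual_mat j (fun a => vscal (sqrt s, 0) (u a))
      (fun a => vscal (sqrt s, 0) (v a)) x y = Cscal s (dual_mat j u v x y).
    rewrite CscalE /dual_mat -csumZ; apply: eq_csum => a.
    case: (D _ _ _); last by ring.
    rewrite /vscal !ConjM Conj_real !CscalE.
    have -> : (s, 0) = Cmul (sqrt s, 0) (sqrt s, 0) by cx.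
    by ring.
  by case: b.
rewrite /dual_weight -rsumZ; apply: eq_rsum => a; rewrite /vscal !Cnorm2M.
have -> : Cnorm2 (sqrt s, 0) = s by rewrite -[RHS]ss /Cnorm2 /=; ring.
by field.
Qed.

Lemma dual_mat_herm (A : finType) (j : A -> J) u v : hermitian (dual_mat j u v).
Proof.
move=> x y; rewrite /dual_mat csum_conj; apply: eq_csum => a.
rewrite (Dsym _ y x); case: (D _ _ _); last by rewrite Conj0.
by rewrite !CscalE !(ConjM, ConjD, ConjK, Conj_real); ring.
Qed.

Lemma dual_mat_diag (A : finType) (j : A -> J) u v x : dual_mat j u v x x = C0.
Proof. by rewrite /dual_mat; apply: csum_eq0 => a; rewrite Dirr. Qed.

Definition gen_mat j (u v : vec X) := dual_mat (fun _ : unit => j) (fun=> u) (fun=> v).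
Definition gen_weight (u v : vec X) := dual_weight (fun _ : unit => u) (fun=> v).

Lemma gen_weightE u v x : gen_weight u v x = (Cnorm2 (u x) + Cnorm2 (v x)) / 2.
Proof. by rewrite /gen_weight /dual_weight rsum_const /cardR card_unit /=; field. Qed.

Lemma gen_matE j u v x y : gen_mat j u v x y =
  if D j x y then Cscal (1 / 2) (Cadd (Cmul (Cconj (u x)) (v y))
                                      (Cmul (Cconj (v x)) (u y))) else C0.
Proof. by rewrite /gen_mat /dual_mat /csum (big_pred1 tt) //; case. Qed.

Lemma gen_weight_ge0 u v x : 0 <= gen_weight u v x.
Proof. by rewrite gen_weightE; have := Cnorm2_ge0 (u x); have := Cnorm2_ge0 (v x); lra. Qed.

Lemma gen_mat_le j u v x y :
  Rabs (fst (gen_mat j u v x y)) <= (gen_weight u v x + gen_weight u v y) / 2 /\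
  Rabs (snd (gen_mat j u v x y)) <= (gen_weight u v x + gen_weight u v y) / 2.
Proof.
have := gen_weight_ge0 u v x; have := gen_weight_ge0 u v y.
rewrite !gen_weightE gen_matE; case: (D _ _ _) => /=; last by rewrite Rabs_R0; lra.
move=> _ _; rewrite /Cnorm2; move: (u x) (u y) (v x) (v y) => [a b] [c d] [e f] [g h] /=.
have sq := Rle_0_sqr; rewrite /Rsqr in sq.
split; apply: Rabs_le; split.
- have := sq (a + g); have := sq (b + h); have := sq (e + c); have := sq (f + d); lra.
- have := sq (a - g); have := sq (b - h); have := sq (e - c); have := sq (f - d); lra.
- have := sq (a + h); have := sq (b - g); have := sq (e + d); have := sq (f - c); lra.
- have := sq (a - h); have := sq (b + g); have := sq (e - d); have := sq (f + c); lra.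
Qed.

(** The length of a generator is at most linear in its total weight, because each entry is bounded
    by the average of two weights. The separation error, proportional to length, can therefore be
    absorbed as a constant shift of the weights. *)
Lemma rdot_gen_le j u v :
  let b := (2 * cardR X + 1) * rsum (gen_weight u v) in
  rdot (pack (gen_mat j u v) (gen_weight u v)) (pack (gen_mat j u v) (gen_weight u v))
  <= b * b.
Proof.
move=> b; rewrite {}/b; set t := gen_weight u v.
pose w := pack (fun x y => ((t x + t y) / 2, (t x + t y) / 2)) t.
have -> : (2 * cardR X + 1) * rsum t = rsum w.
  rewrite /w rsum_pack /=.
  have -> : rsum (fun x => rsum (fun y => (t x + t y) / 2 + (t x + t y) / 2))
    = rsum (fun x => cardR X * t x + rsum t).
    apply: eq_rsum => x; rewrite -rsum_const -rsumD.
    by apply: eq_rsum => y; field.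
  by rewrite rsumD (rsumZ _ t) rsum_const; ring.
apply: rdot_bound => -[[[x y] b]|x] /=.
  by case: b; case: (gen_mat_le j u v x y).
by rewrite Rabs_pos_eq; [lra | exact: gen_weight_ge0].
Qed.

(** Every ordered pair [(a, b)] gets its own term, with vectors supported at [a] and at [b],
    labelled by a coordinate telling [a] and [b] apart. The pairs [(x, y)] and [(y, x)] each produce
    half of [F x y]. Splitting the entry as [sqrt eta] times [F a b / sqrt eta] keeps both squared
    lengths of order [eta]. *)
Lemma dual_fix_residual (j0 : J) (F : mat X) (eta : R) :
  hermitian F -> (forall x, F x x = C0) -> 0 < eta ->
  (forall x y, Cnorm2 (F x y) <= 2 * (eta * eta)) ->
  exists (A : finType) (jl : A -> J) (u v : A -> vec X),
    (forall x y, dual_mat jl u v x y = F x y) /\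
    (forall x, dual_weight u v x <= 2 * cardR X * eta).
Proof.
move=> Fh Fd eta0 Fs.
(* The default [j0] is reached only by diagonal pairs, whose vector [v] is zero because [F] vanishes
   there. *)
pose jl (a : X * X) := odflt j0 [pick j | D j a.1 a.2].
have jlP x y : x != y -> D (jl (x, y)) x y.
  move=> xy; rewrite /jl /=; case: pickP => //= h.
  by have [j] := Dsep xy; rewrite h.
have se0 : 0 < sqrt eta by exact: sqrt_lt_R0.
have see : sqrt eta * sqrt eta = eta by apply: sqrt_sqrt; lra.
pose u (a : X * X) : vec X := fun x => if a.1 == x then (sqrt eta, 0) else C0.
pose v (a : X * X) : vec X := fun y => if a.2 == y then Cscal (/ sqrt eta) (F a.1 a.2) else C0.
exists (X * X)%type, jl, u, v; split.
  move=> x y; have [<-|xy] := eqVneq x y; first by rewrite dual_mat_diag Fd.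
  transitivity (Cadd (Cscal (1 / 2) (F x y)) (Cscal (1 / 2) (Cconj (F y x)))); last first.
    by rewrite (Fh x y) ConjK; cx.
  rewrite -[X in Cadd X _](csum_delta (x, y) (fun a : X * X => Cscal (1 / 2) (F a.1 a.2))).
  rewrite -[X in Cadd _ X](csum_delta (y, x)
    (fun a : X * X => Cscal (1 / 2) (Cconj (F a.1 a.2)))).
  rewrite -csumD; apply: eq_csum => -[a b] /=; rewrite !xpair_eqE /u /v /=.
  have yx : y != x by rewrite eq_sym.
  have [ax|ax] := eqVneq a x.
    rewrite ax (negPf xy) /=; have [by_|by_] := eqVneq b y.
      rewrite by_ jlP // (negPf yx) /=.
      rewrite !CscalE Conj0 Conj_real.
      have -> : (F x y) = Cmul (Cmul (sqrt eta, 0) (/ sqrt eta, 0)) (F x y).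
        by cx; lra.
      by cx; lra.
    case: (D _ _ _) => //; last by cx.
    by case: (b == x); cx.
  have [ay|ay] := eqVneq a y; last by case: (D _ _ _); case: (b == y); case: (b == x); cx.
  rewrite ay /=; have [bx|bx] := eqVneq b x.
    rewrite bx Dsym jlP // (negPf xy).
    by cx; lra.
  by case: (D _ _ _); case: (b == y); cx.
move=> x; rewrite /dual_weight rsum_pair.
have X0 : 0 <= cardR X by exact: pos_INR.
(* The vectors [u] of the pairs [(x, b)] contribute [cardR X * (eta / 2)]; the vectors [v] of the
   pairs [(a, x)] contribute at most [eta] each. *)
apply: (@Rle_trans _ (rsum (fun a : X => (if a == x then cardR X * (eta / 2) else 0) + eta)));
  last by rewrite rsumD rsum_delta rsum_const; nra.
apply: rsum_le => a.
have -> : (if a == x then cardR X * (eta / 2) else 0)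
  = rsum (fun b : X => if a == x then eta / 2 else 0).
  by rewrite rsum_const; case: (a == x); ring.
rewrite -[X in _ + X](rsum_delta x (fun=> eta)) -rsumD; apply: rsum_le => b.
rewrite /u /v /=.
have F1 : / sqrt eta * / sqrt eta * Cnorm2 (F a b) <= 2 * eta.
  rewrite -Rinv_mult see; apply: (Rmult_le_reg_l eta) => //.
  have -> : eta * (/ eta * Cnorm2 (F a b)) = Cnorm2 (F a b) by field; lra.
  by have := Fs a b; lra.
have E0 : Cnorm2 C0 = 0 by rewrite /Cnorm2 /=; ring.
have E1 : Cnorm2 (sqrt eta, 0) = eta by rewrite /Cnorm2 /= see; ring.
by case: (a == x); case: (b == x); rewrite ?Cnorm2_scal ?E0 ?E1; lra.
Qed.

(** Pairing with a generator is a sesquilinear form in the masked conjugate of [G]; this is how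
    separation of generators becomes an operator norm bound for each coordinate. *)
Lemma mdot_gen j (G : mat X) u v : hermitian G ->
  fst (mdot G (gen_mat j u v))
  = fst (inner u (mulmv (fun x y => if D j x y then Cconj (G x y) else C0) v)).
Proof.
move=> hG.
pose S := csum (fun x => csum (fun y => Cmul (Cconj (u x))
  (Cmul (if D j x y then Cconj (G x y) else C0) (v y)))).
have -> : inner u (mulmv (fun x y => if D j x y then Cconj (G x y) else C0) v) = S.
  by apply: eq_csum => x; rewrite -csumZ.
suff -> : mdot G (gen_mat j u v) = Cmul (1 / 2, 0) (Cadd S (Cconj S)) by rewrite /=; lra.
rewrite {2}/S csum_conj.
have -> : csum (fun x => Cconj (csum (fun y => Cmul (Cconj (u x))
  (Cmul (if D j x y then Cconj (G x y) else C0) (v y)))))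
  = csum (fun x => csum (fun y => Cmul (Cconj (v x))
  (Cmul (if D j x y then Cconj (G x y) else C0) (u y)))).
  rewrite csum_exchange; apply: eq_csum => x; rewrite csum_conj.
  apply: eq_csum => y; rewrite !ConjM ConjK (Dsym j y x).
  by case: (D _ _ _); rewrite ?(hG x y) ?ConjK ?Conj0; ring.
rewrite /S -csumD -csumZ; apply: eq_csum => x; rewrite -csumD -csumZ.
apply: eq_csum => y; rewrite gen_matE; case: (D _ _ _); last by ring.
by rewrite CscalE; ring.
Qed.

(* The separating functional [(Gam, - be)] from the cone is an unnormalised
   adversary matrix: rescaling by [be^(-1/2)] on both sides makes it feasible,
   and testing it on the vector [be^(1/2)] contradicts the bound [W]. *)
Lemma adversary_dual (j0 : J) (E : mat X) (W : R) :
  hermitian E -> (forall x, E x x = C0) -> 0 <= W ->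
  (forall G, hermitian G ->
     (forall j, opnorm_le (fun x y => if D j x y then G x y else C0) 1) ->
     forall v, fst (inner v (mulmv (hadamard G E) v)) <= W * norm2 v) ->
  forall del, 0 < del ->
  exists (A : finType) (jl : A -> J) (u v : A -> vec X),
    (forall x y, dual_mat jl u v x y = E x y) /\
    (forall x, dual_weight u v x <= W + del).
Proof.
move=> Eh Ed W0 bound del del0.
have X0 : 0 <= cardR X by exact: pos_INR.
pose p := pack E (fun=> W).
have subE M t : (fun i => p i - pack M t i) = pack (msub E M) (fun x => W - t x).
  apply: functional_extensionality => -[[[x y] b]|x] //=.
  by case: b.
have [[m [m0 far]]|near] := classic (exists m, 0 < m /\ forall z, dual_cone z ->
    m <= rdot (fun i => p i - z i) (fun i => p i - z i)); last first.
  (* Of the excess weight, [eta] comes from the approximating cone element and [2 * cardR X * eta]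
     from repairing its residual; together they make [del]. *)
  pose eta := del / (2 * cardR X + 1).
  have eta0 : 0 < eta by apply: Rdiv_lt_0_compat; lra.
  have etaE : eta * (2 * cardR X + 1) = del by rewrite /eta; field; lra.
  have [z [[A [jl [u [v zE]]]] zp]] : exists z, dual_cone z /\
      rdot (fun i => p i - z i) (fun i => p i - z i) < eta * eta.
    apply: NNPP => h; apply: near; exists (eta * eta); split; first by nra.
    move=> z Kz; apply: Rnot_lt_le => lt; apply: h; by exists z.
  rewrite zE subE in zp.
  have coord i : pack (msub E (dual_mat jl u v)) (fun x => W - dual_weight u v x) i
      * pack (msub E (dual_mat jl u v)) (fun x => W - dual_weight u v x) i < eta * eta.
    apply: Rle_lt_trans zp.
    by apply: (rsum_ge_term i (F := fun i => _ i * _ i)) => k; nra.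
  have [||||A' [jl' [u' [v' [h1 h2]]]]] :=
      @dual_fix_residual j0 (msub E (dual_mat jl u v)) eta.
  - by move=> x y; rewrite /msub (Eh x y) (dual_mat_herm jl u v x y) ConjB.
  - by move=> x; rewrite /msub Ed dual_mat_diag; ring.
  - by [].
  - move=> x y; have := coord (inl (x, y, false)); have := coord (inl (x, y, true)).
    by rewrite /= /Cnorm2 /=; lra.
  exists (A + A')%type, (fun c => match c with inl a => jl a | inr b => jl' b end),
    (fun c => match c with inl a => u a | inr b => u' b end),
    (fun c => match c with inl a => v a | inr b => v' b end); split.
    by move=> x y; rewrite dual_matD h1 /msub; ring.
  move=> x; rewrite dual_weightD.
  have := coord (inr x) => /=; have := h2 x => h2x cx.
  have : dual_weight u v x - W <= eta by nra.
  lra.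
exfalso.
pose c := 2 * cardR X + 1.
(* Chosen so that the total error in the final comparison is at most [m / 4], strictly below the
   margin [m / 2]; [W + 1] and [cardR X + 1] keep the denominator positive. *)
pose eta := m / (8 * (W + 1) * c * (cardR X + 1)).
have c0 : 0 < c by rewrite /c; lra.
have den0 : 0 < 8 * (W + 1) * c * (cardR X + 1).
  by apply: Rmult_lt_0_compat; [apply: Rmult_lt_0_compat; lra | lra].
have eta0 : 0 < eta by exact: Rdiv_lt_0_compat.
have etaE : eta * c * (W + 1) * (cardR X + 1) = m / 8.
  by rewrite /eta; field; split; lra.
have [|_ [[A [jl [ua [va ->]]]] gp gz]] :=
  @cone_separation _ dual_cone p m eta _ dual_cone_add dual_cone_scal m0 eta0 far.
  by exists (pack (dual_mat (fun a : 'I_0 => j0) (fun=> fun=> C0) (fun=> fun=> C0))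
    (dual_weight (fun _ : 'I_0 => fun=> C0) (fun=> fun=> C0))); eexists; eexists; eexists; eexists.
rewrite subE in gp gz.
set Gam := msub E _ in gp gz.
have Gh : hermitian Gam.
  by move=> x y; rewrite /Gam /msub (Eh x y) (dual_mat_herm jl ua va x y) ConjB.
clearbody Gam.
pose e := eta * c.
have e0 : 0 < e by exact: Rmult_lt_0_compat.
(* One [e] absorbs the separation error; the second makes [be] strictly positive, so that division
   by its square root is possible. *)
pose be x := dual_weight ua va x - W + 2 * e.
have sep j u v : fst (mdot Gam (gen_mat j u v))
    <= rsum (fun x => (be x - e) * gen_weight u v x).
  have := gz _ (c * rsum (gen_weight u v)) _ _ (rdot_gen_le j u v).
  rewrite rdot_pack => /(_ _ _).
  have -> : rsum (fun x => (be x - e) * gen_weight u v x)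
    = eta * (c * rsum (gen_weight u v))
      + (-1) * rsum (fun x => (W - dual_weight ua va x) * gen_weight u v x).
    rewrite -Rmult_assoc -!rsumZ -rsumD; apply: eq_rsum => x.
    by rewrite /be /e; ring.
  suff h : forall a b d : R, a + b <= d -> a <= d + -1 * b.
    move=> H; apply: h; apply: H.
      by exists unit, (fun=> j), (fun=> u), (fun=> v).
    apply: Rmult_le_pos; first lra.
    by apply: rsum_ge0 => x; exact: gen_weight_ge0.
  by move=> *; lra.
have be0 x : 0 < be x.
  (* A generator supported at the single point [x] has zero matrix but positive weight, so the
     separating inequality reads [0 <= be x - e]. *)
  have := sep j0 (delta x) (delta x).
  have -> : rsum (fun y => (be y - e) * gen_weight (delta x) (delta x) y) = be x - e.
    rewrite -[RHS](rsum_delta x (fun y => be y - e)); apply: eq_rsum => y.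
    rewrite gen_weightE /delta; case: (y == x); rewrite /Cnorm2 /=; field.
  have -> : mdot Gam (gen_mat j0 (delta x) (delta x)) = C0.
    apply: csum_eq0 => a; apply: csum_eq0 => b; rewrite gen_matE /delta.
    have [->|_] := eqVneq a x; have [->|_] := eqVneq b x.
    - by rewrite Dirr; ring.
    - by case: (D _ _ _); cx.
    - by case: (D _ _ _); cx.
    - by case: (D _ _ _); cx.
  by rewrite /=; lra.
have sb0 x : 0 < sqrt (be x) by exact: sqrt_lt_R0.
have sbb x : sqrt (be x) * sqrt (be x) = be x by apply: sqrt_sqrt; have := be0 x; lra.
pose ib x : Cx := (/ sqrt (be x), 0).
have ibE x : Cmul (sqrt (be x), 0) (ib x) = C1 by move: (sb0 x) => h; cx; lra.
have ibn x : be x * Cnorm2 (ib x) = 1.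
  by rewrite -(sbb x) /Cnorm2 /=; field; have := sb0 x; lra.
have ibc x : Cconj (ib x) = ib x by exact: Conj_real.
pose G : mat X := fun x y => Cmul (Cmul (ib x) (ib y)) (Cconj (Gam x y)).
have GhG : hermitian G.
  by move=> x y; rewrite /G (Gh x y) !ConjM !ibc ConjK; ring.
have Gf j : opnorm_le (fun x y => if D j x y then G x y else C0) 1.
  move=> v; rewrite Rmult_1_l !vnormE; apply: sqrt_le_1_alt.
  (* Testing the generator built from the image [u] and from [v], both rescaled, gives
     [norm2 u <= (norm2 u + norm2 v) / 2], hence [norm2 u <= norm2 v]. *)
  set u := mulmv _ v.
  pose u' : vec X := fun x => Cmul (ib x) (u x).
  pose v' : vec X := fun x => Cmul (ib x) (v x).
  have := sep j u' v'; rewrite mdot_gen //.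
  have -> : inner u' (mulmv (fun x y => if D j x y then Cconj (Gam x y) else C0) v')
      = inner u u.
    apply: eq_csum => x; rewrite /u' ConjM ibc.
    rewrite (_ : Cmul (Cmul (ib x) _) _ = Cmul (Cconj (u x))
      (Cmul (ib x) (mulmv (fun x y => if D j x y then Cconj (Gam x y) else C0) v' x)));
      last by ring.
    congr Cmul; rewrite /u /mulmv -csumZ; apply: eq_csum => y.
    by rewrite /v' /G; case: (D _ _ _); ring.
  rewrite inner_self /= => h.
  have : rsum (fun x => (be x - e) * gen_weight u' v' x)
      <= (norm2 u + norm2 v) / 2.
    have -> : (norm2 u + norm2 v) / 2 = (1 / 2) * (norm2 u + norm2 v) by field.
    rewrite /norm2 -rsumD -rsumZ; apply: rsum_le => x.
    have -> : 1 / 2 * (Cnorm2 (u x) + Cnorm2 (v x)) = be x * gen_weight u' v' x.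
      rewrite gen_weightE /u' /v' !Cnorm2M.
      by rewrite (_ : be x * _ = (be x * Cnorm2 (ib x)) * ((Cnorm2 (u x) + Cnorm2 (v x)) / 2));
        [rewrite ibn; field | field].
    by have := gen_weight_ge0 u' v' x; nra.
  lra.
pose sv : vec X := fun x => (sqrt (be x), 0).
have := bound G GhG Gf sv.
have -> : norm2 sv = rsum be.
  by apply: eq_rsum => x; rewrite /Cnorm2 /= sbb; ring.
have -> : inner sv (mulmv (hadamard G E) sv) = mdot Gam E.
  apply: eq_csum => x; rewrite -csumZ; apply: eq_csum => y.
  rewrite /hadamard /G /sv Conj_real.
  rewrite (_ : Cmul _ _ = Cmul (Cmul (Cmul (sqrt (be x), 0) (ib x))
    (Cmul (sqrt (be y), 0) (ib y))) (Cmul (Cconj (Gam x y)) (E x y))); last by ring.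
  by rewrite !ibE; ring.
rewrite rdot_pack in gp.
(* The margin [m / 2] is at most [mdot Gam E - W * rsum be] plus an error. The adversary bound makes
   the difference nonpositive, leaving only the error, which is too small. *)
have E1 : rsum (fun x => (W - dual_weight ua va x) * W) = - W * rsum be + cardR X * (2 * e * W).
  rewrite -rsum_const -rsumZ -rsumD; apply: eq_rsum => x; rewrite /be; ring.
rewrite E1 in gp => h.
have : m / 2 <= 2 * (e * W * cardR X) by lra.
have : e * W * cardR X <= e * (W + 1) * (cardR X + 1).
  by apply: Rmult_le_compat; nra.
rewrite /e etaE; lra.
Qed.

End Duality.

(** * From the adversary bound to dual vectors *)

Lemma vnorm_scal (I : finType) (c : R) (v : vec I) : 0 <= c ->
  vnorm (vscal (c, 0) v) = c * vnorm v.
Proof.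
move=> c0; rewrite !vnormE norm2_scal.
have -> : Cnorm2 (c, 0) = c * c by rewrite /Cnorm2 /=; ring.
by rewrite sqrt_mult ?sqrt_square //; [nra | exact: norm2_ge0].
Qed.

Lemma vnorm_delta (I : finType) (k : I) : vnorm (delta k) = 1.
Proof.
rewrite vnormE -sqrt_1; congr sqrt.
rewrite -[RHS](rsum_delta k (fun=> 1)); apply: eq_rsum => i.
by rewrite /delta; case: (i == k); rewrite /Cnorm2 /=; ring.
Qed.

(** Adversary values are defined through a least upper bound, so an actual operator norm is required
    before a feasible matrix can be compared with [adv]. A crude bound on each coordinate of the
    image of a unit vector supplies completeness with an upper bound. *)
Lemma opnorm_exists (I : finType) (i0 : I) (M : mat I) : exists r, is_opnorm M r.
Proof.
have [||r hr] := completeness (fun s => exists v : vec I, vnorm v = 1 /\ s = vnorm (mulmv M v));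
  last by exists r.
- pose B i := (rsum (fun j => Cnorm2 (M i j)) + 1) / 2.
  exists (sqrt (rsum (fun i => 2 * (B i * B i)))) => _ [v [v1 ->]].
  rewrite vnormE; apply: sqrt_le_1_alt; apply: rsum_le => i.
  have v1' : norm2 v = 1 by rewrite -vnorm_sqr v1; ring.
  have entry (f : Cx -> R) : (forall P : I -> Cx, f (csum P) = rsum (fun j => f (P j))) ->
      (forall a b, - ((Cnorm2 a + Cnorm2 b) / 2) <= f (Cmul a b) <= (Cnorm2 a + Cnorm2 b) / 2) ->
      f (mulmv M v i) * f (mulmv M v i) <= B i * B i.
    move=> fs fb.
    have BE : B i = rsum (fun j => (1 / 2) * (Cnorm2 (M i j) + Cnorm2 (v j))).
      by rewrite rsumZ rsumD -/(norm2 v) v1' /B; field.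
    have h1 : f (mulmv M v i) <= B i.
      by rewrite /mulmv fs BE; apply: rsum_le => j; have := fb (M i j) (v j); lra.
    have h2 : - B i <= f (mulmv M v i).
      have -> : - B i = (-1) * B i by ring.
      rewrite /mulmv fs BE -rsumZ; apply: rsum_le => j.
      by have := fb (M i j) (v j); lra.
    nra.
  have := entry (fun a => fst a) (@fst_csum I); have := entry (fun a => snd a) (@snd_csum I).
  have sq := Rle_0_sqr; rewrite /Rsqr in sq.
  rewrite {3}/Cnorm2 => h1 h2.
  apply: (@Rle_trans _ (B i * B i + B i * B i)); last lra.
  apply: Rplus_le_compat; [apply: h2 | apply: h1] => -[a b] [c d]; rewrite /Cnorm2 /=.
    by have := sq (a + c); have := sq (a - c); have := sq (b + d); have := sq (b - d); lra.
  by have := sq (a + d); have := sq (a - d); have := sq (b + c); have := sq (b - c); lra.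
- by exists (vnorm (mulmv M (delta i0))), (delta i0); split => //; exact: vnorm_delta.
Qed.

Lemma unit_gram_herm (I : finType) (rho : mat I) : unit_gram rho -> hermitian rho.
Proof. by move=> [m [v [_ h]]] x y; rewrite !h inner_conj. Qed.

Lemma unit_gram_diag (I : finType) (rho : mat I) x : unit_gram rho -> rho x x = C1.
Proof.
by move=> [m [v [h1 h]]]; rewrite h inner_self -vnorm_sqr h1 /C1; congr pair; ring.
Qed.

Definition differ (S : finType) (n : nat) (X : {set n.-tuple S}) (j : 'I_n)
  (x y : Xidx X) : bool := tnth (val x) j != tnth (val y) j.

Lemma Adv_dual (S : finType) (n : nat) (X : {set n.-tuple S})
  (rho sigma : mat (Xidx X)) (adv : R) :
  (1 <= n)%nat -> unit_gram rho -> unit_gram sigma -> is_Adv rho sigma adv ->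
  0 <= adv /\ forall del, 0 < del ->
  exists (A : finType) (jl : A -> 'I_n) (u v : A -> vec (Xidx X)),
    (forall x y, dual_mat (@differ S n X) jl u v x y = msub rho sigma x y) /\
    (forall x, dual_weight u v x <= adv + del).
Proof.
move=> n0 urho usig [ub lub].
have DeltaE (G : mat (Xidx X)) j :
    hadamard G (@Delta _ _ X j) = fun x y => if differ j x y then G x y else C0.
  apply: functional_extensionality => x; apply: functional_extensionality => y.
  by rewrite /hadamard /Delta /differ; case: eqP => _ /=; ring.
(* If [X] were empty there would be no unit vector, hence no operator norm and no adversary value,
   and [adv] would be a least upper bound of the empty set, which does not exist. *)
have [x0] : exists x : Xidx X, True.
  apply: NNPP => h; have : adv <= adv - 1; last by lra.
  apply: lub => r [G [_ [_ lr]]]; have : r <= r - 1; last by lra.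
  apply: lr => s [v [v1 _]]; case: h.
  apply: NNPP => h'; move: v1; rewrite vnormE /norm2.
  have -> : rsum (fun i => Cnorm2 (v i)) = 0.
    by apply: rsum_eq0 => i; case: h'; exists i.
  by rewrite sqrt_0; lra.
move=> _.
have vals (G : mat (Xidx X)) : hermitian G ->
    (forall j, opnorm_le (fun x y => if differ j x y then G x y else C0) 1) ->
    forall v, vnorm v = 1 -> vnorm (mulmv (hadamard G (msub rho sigma)) v) <= adv.
  move=> Gh Gf v v1.
  have [r hr] := opnorm_exists x0 (hadamard G (msub rho sigma)).
  apply: (@Rle_trans _ r); first by apply: (proj1 hr); exists v.
  apply: ub; exists G; split => //; split => // j; rewrite DeltaE; exact: Gf.
have unitv (v : vec (Xidx X)) : 0 < vnorm v -> vnorm (vscal (/ vnorm v, 0) v) = 1.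
  move=> v0; rewrite vnorm_scal; first by field; lra.
  by have := Rinv_0_lt_compat _ v0; lra.
have d1 := vnorm_delta x0.
(* The zero matrix is feasible. *)
have adv0 : 0 <= adv.
  apply: Rle_trans (vals (fun _ _ => C0) _ _ (delta x0) d1); first exact: vnorm_ge0.
    by move=> x y; rewrite Conj0.
  move=> j v; rewrite (_ : mulmv _ v = fun=> C0).
    have -> : vnorm (fun _ : Xidx X => C0) = 0.
      rewrite vnormE -sqrt_0; congr sqrt; apply: rsum_eq0 => i.
      by rewrite /Cnorm2 /=; ring.
    by have := vnorm_ge0 v; lra.
  apply: functional_extensionality => i; apply: csum_eq0 => k.
  by case: differ; ring.
split => //; apply: adversary_dual => //.
- by move=> j x y; rewrite /differ eq_sym.
- by move=> j x; rewrite /differ eqxx.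
- move=> x y xy; apply: NNPP => h; case/negP: xy; apply/eqP; apply: val_inj.
  apply: eq_from_tnth => j; apply/eqP; apply/negPn/negP => hj.
  by apply: h; exists j.
- exact: (Ordinal n0).
- by move=> x y; rewrite /msub (unit_gram_herm urho x y) (unit_gram_herm usig x y) ConjB.
- by move=> x; rewrite /msub !unit_gram_diag //; ring.
- move=> G Gh Gf v.
  have [v0|v0] : vnorm v = 0 \/ 0 < vnorm v by have := vnorm_ge0 v; lra.
    have := Re_inner_le v (mulmv (hadamard G (msub rho sigma)) v).
    by rewrite -vnorm_sqr v0; lra.
  apply: Rle_trans (Re_inner_le _ _) _; rewrite -vnorm_sqr.
  have := vals G Gh Gf _ (unitv v v0); rewrite mulmvZ vnorm_scal; last first.
    by have := Rinv_0_lt_compat _ v0; lra.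
  move=> h.
  have := Rmult_le_compat_l (vnorm v * vnorm v) _ _ _ h.
  rewrite (_ : vnorm v * vnorm v * (/ vnorm v * _) = vnorm v
     * vnorm (mulmv (hadamard G (msub rho sigma)) v)); last by field; lra.
  by move=> /(_ _); rewrite (Rmult_comm adv); apply; nra.
Qed.

(** * Evolution under a multiple of a projection *)

Definition cexpN (th : R) : Cx := (cos th, - sin th).

(** For a projection [P] this is the exponential of [- i th P]: the phase [cexpN th] on the range of
    [P] and the identity on its complement. *)
Definition propagator (I : finType) (P : mat I) (th : R) : mat I :=
  fun p q => Cadd (@idmat I p q) (Cmul (Csub (cexpN th) C1) (P p q)).

Definition projection (I : finType) (P : mat I) : Prop :=
  hermitian P /\ forall v, mulmv P (mulmv P v) = mulmv P v.

Definition isometry (I : finType) (V : mat I) : Prop :=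
  forall u v, inner (mulmv V u) (mulmv V v) = inner u v.

Lemma mulmv_propagator (I : finType) (P : mat I) th v :
  mulmv (propagator P th) v = vadd v (vscal (Csub (cexpN th) C1) (mulmv P v)).
Proof.
rewrite -{2}(mulmv1 v); apply: functional_extensionality => i.
rewrite /vadd /vscal /mulmv /propagator -csumZ -csumD.
by apply: eq_csum => j; ring.
Qed.

Lemma cexpN_norm th : Cmul (Cconj (cexpN th)) (cexpN th) = C1.
Proof.
have := sin2_cos2 th; rewrite /Rsqr => h.
by rewrite Cconj_mulE /Cnorm2 /C1 /=; congr pair; lra.
Qed.

Lemma propagator_isometry (I : finType) (P : mat I) th :
  projection P -> isometry (propagator P th).
Proof.
move=> [Ph Pi] u v; rewrite !mulmv_propagator !(innerDl, innerDr, innerZl, innerZr).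
rewrite -(inner_hermitian u (mulmv P v) Ph) -(inner_hermitian u v Ph) Pi ConjB Conj1.
have := cexpN_norm th; move: (cexpN th) (inner u (mulmv P v)) => z a h.
transitivity (Cadd (inner u v) (Cmul (Csub (Cmul (Cconj z) z) C1) a)); first by ring.
by rewrite h; ring.
Qed.

Lemma propagator0 (I : finType) (P : mat I) : propagator P 0 = @idmat I.
Proof.
apply: mat_eq => v; rewrite mulmv_propagator mulmv1.
apply: functional_extensionality => i; rewrite /vadd /vscal /cexpN sin_0 cos_0.
by cx.
Qed.

Lemma mulmm_propagator (I : finType) (P B : mat I) th p q :
  mulmm (propagator P th) B p q
  = Cadd (B p q) (Cmul (Csub (cexpN th) C1) (mulmm P B p q)).
Proof. exact: (f_equal (fun f => f p) (mulmv_propagator P th (fun k => B k q))). Qed.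

Lemma mulmm_proj_propagator (I : finType) (P B : mat I) th p q : projection P ->
  mulmm P (mulmm (propagator P th) B) p q = Cmul (cexpN th) (mulmm P B p q).
Proof.
move=> [_ Pi]; set b : vec I := fun k => B k q.
change (mulmv P (mulmv (propagator P th) b) p = Cmul (cexpN th) (mulmv P b p)).
rewrite mulmv_propagator mulmvD mulmvZ Pi /vadd /vscal; ring.
Qed.

(** The real and imaginary parts of an entry of a propagator times a fixed matrix both have this
    form, with [m1], [m2] taken, up to sign and order, from the projected entry. *)
Lemma derivable_pt_lim_trig (a b m1 m2 c T t : R) :
  derivable_pt_lim
    (fun s => a + (cos (c * (s - T)) - b) * m1 + sin (c * (s - T)) * m2) t
    (c * (- sin (c * (t - T)) * m1 + cos (c * (t - T)) * m2)).
Proof.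
have lin : derivable_pt_lim (fun s => c * (s - T)) t c.
  have := derivable_pt_lim_scal _ c t _
    (derivable_pt_lim_minus _ _ t _ _ (derivable_pt_lim_id t) (derivable_pt_lim_const T t)).
  by rewrite Rminus_0_r Rmult_1_r.
have dc := derivable_pt_lim_comp _ _ _ _ _ lin (derivable_pt_lim_cos (c * (t - T))).
have ds := derivable_pt_lim_comp _ _ _ _ _ lin (derivable_pt_lim_sin (c * (t - T))).
have := derivable_pt_lim_plus _ _ t _ _
  (derivable_pt_lim_plus _ _ t _ _ (derivable_pt_lim_const (a - b * m1) t)
    (derivable_pt_lim_scal _ m1 t _ dc)) (derivable_pt_lim_scal _ m2 t _ ds).
set l := (X in derivable_pt_lim _ _ X); set l' := (X in _ -> derivable_pt_lim _ _ X).
have -> : l = l' by rewrite /l /l'; ring.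
move=> h; rewrite (_ : (fun s => _) = plus_fct (plus_fct (fct_cte (a - b * m1))
  (mult_real_fct m1 (comp cos (fun s => c * (s - T)))))
  (mult_real_fct m2 (comp sin (fun s => c * (s - T))))) //.
apply: functional_extensionality => s.
by rewrite /plus_fct /fct_cte /mult_real_fct /comp; ring.
Qed.

(** * Gluing evolutions in time *)

Definition glue (A : Type) (T : R) (f g : R -> A) (t : R) : A :=
  if Rle_dec t T then f t else g t.

Lemma glue_le (A : Type) T (f g : R -> A) t : t <= T -> glue T f g t = f t.
Proof. by rewrite /glue; case: Rle_dec. Qed.

Lemma glue_gt (A : Type) T (f g : R -> A) t : T < t -> glue T f g t = g t.
Proof. by rewrite /glue; case: Rle_dec => // h h'; lra. Qed.

Lemma derivable_pt_lim_near (f g : R -> R) t l a b :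
  a < t < b -> (forall s, a < s < b -> f s = g s) ->
  derivable_pt_lim f t l -> derivable_pt_lim g t l.
Proof.
move=> tab fg df eps eps0; have [d hd] := df eps eps0.
have d0 : 0 < Rmin d (Rmin (t - a) (b - t)).
  by apply: Rmin_pos; [exact: cond_pos | apply: Rmin_pos; lra].
exists (mkposreal _ d0) => h h0 /= hh.
have h1 : Rabs h < d by apply: Rlt_le_trans hh (Rmin_l _ _).
have h2 : Rabs h < Rmin (t - a) (b - t) by apply: Rlt_le_trans hh (Rmin_r _ _).
have h3 : Rabs h < t - a by apply: Rlt_le_trans h2 (Rmin_l _ _).
have h4 : Rabs h < b - t by apply: Rlt_le_trans h2 (Rmin_r _ _).
have := Rle_abs h; have := Rle_abs (- h); rewrite Rabs_Ropp => *.
by rewrite -!fg; [exact: hd | lra | lra].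
Qed.

Lemma glue_limit (f g : R -> R) (T tau t : R) :
  (forall s, 0 <= s <= T -> limit1_in f (fun s => 0 <= s <= T) (f s) s) ->
  continuity g -> g T = f T -> 0 <= t <= T + tau ->
  limit1_in (glue T f g) (fun s => 0 <= s <= T + tau) (glue T f g t) t.
Proof.
move=> lf cg gT t0.
have Lf : t <= T -> forall eps, 0 < eps -> exists d, 0 < d /\
    forall s, 0 <= s <= T -> Rabs (s - t) < d -> Rabs (f s - f t) < eps.
  move=> tT eps eps0; have [||d [d0 hd]] := lf t _ eps; try lra.
  by exists d; split => // s sT sd; apply: hd.
have Lg eps : 0 < eps -> exists d, 0 < d /\
    forall s, Rabs (s - t) < d -> Rabs (g s - g t) < eps.
  move=> eps0; have [|d [d0 hd]] := cg t eps; first lra.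
  exists d; split => // s sd; have [->|st] := Req_dec s t.
    by rewrite Rminus_diag Rabs_R0.
  by apply: hd; split => //; split => // ts; apply: st.
move=> eps eps0; rewrite /= /Rdist.
have {}eps0 : 0 < eps by lra.
have [tT|tT] := Rle_lt_dec t T; last first.
  have [d [d0 hd]] := Lg _ eps0.
  exists (Rmin d (t - T)); split; first by apply: Rmin_pos; lra.
  move=> s [sT sd]; rewrite (glue_gt _ _ tT).
  have s1 := Rlt_le_trans _ _ _ sd (Rmin_l _ _).
  have s2 := Rlt_le_trans _ _ _ sd (Rmin_r _ _).
  rewrite glue_gt; first exact: hd.
  by move/Rabs_def2: s2; lra.
rewrite (glue_le _ _ tT); have [d [d0 hd]] := Lf tT _ eps0.
have [tlT|tT'] : t < T \/ t = T by lra.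
  exists (Rmin d (T - t)); split; first by apply: Rmin_pos; lra.
  move=> s [sT sd].
  have s1 := Rlt_le_trans _ _ _ sd (Rmin_l _ _).
  have s2 := Rlt_le_trans _ _ _ sd (Rmin_r _ _).
  have sT' : s <= T by move/Rabs_def2: s2; lra.
  by rewrite glue_le //; apply: hd => //; lra.
(* At the junction [t = T], points to the left are controlled by [f] and points to the right by [g],
   whose value at [T] agrees. *)
have [d' [d0' hd']] := Lg _ eps0.
exists (Rmin d d'); split; first exact: Rmin_pos.
move=> s [sT sd].
have s1 := Rlt_le_trans _ _ _ sd (Rmin_l _ _).
have s2 := Rlt_le_trans _ _ _ sd (Rmin_r _ _).
have [sT'|sT'] := Rle_lt_dec s T.
  by rewrite glue_le //; apply: hd => //; lra.
by rewrite glue_gt //; move: (hd' s s2); rewrite tT' gT.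
Qed.

Lemma glue_pw_cont (f : R -> R) (a T tau c : R) : 0 < tau ->
  pw_cont f a T -> pw_cont (glue T f (fun=> c)) a (T + tau).
Proof.
move=> tau0 [k [pts [p0 [pk [pinc pf]]]]].
have ple i : (i <= k)%N -> pts i <= T.
  rewrite -pk; elim: k {p0 pk pf} pinc => [|k IH] pinc.
    by rewrite leqn0 => /eqP ->; lra.
  rewrite leq_eqVlt => /orP [/eqP -> |]; first lra.
  rewrite ltnS => ik; have := pinc k (ltnSn k).
  have : pts i <= pts k by apply: IH => // j jk; apply: pinc; exact: ltnW.
  lra.
exists k.+1, (fun i => if (i <= k)%N then pts i else T + tau).
split; first by [].
split; first by rewrite ltnn.
split=> i; rewrite ltnS => ik; rewrite ik.
  case: ltnP => [ik'|ki]; first exact: pinc.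
  by have := ple i ik; lra.
case: ltnP => [ik'|ki].
  have [g [cg fg]] := pf i ik'; exists g; split => // t ht.
  by rewrite glue_le; [exact: fg | have := ple _ ik'; lra].
have -> : i = k by apply/eqP; rewrite eqn_leq ik ki.
exists (fun=> c); split; first by apply: continuity_const.
by move=> t ht; rewrite glue_gt //; rewrite -pk; lra.
Qed.

(** * Unitaries reachable in a given time *)

Section Reachable.
Variables (S : finType) (n : nat) (X : {set n.-tuple S}) (w d : nat).
Notation I := (Idx S n w d).

(** The dynamical half of [ct_converts], with the states to be converted left out and only the final
    operators recorded, so that algorithms can be extended one piece at a time. Isometry is carried
    as an invariant. *)
Definition reachable (T : R) (V : Xidx X -> mat I) : Prop :=
  exists (HD : R -> mat I) (alpha : R -> R) (U : Xidx X -> R -> mat I),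
    0 <= T /\
    (forall t, 0 <= t <= T -> hermitian (HD t)) /\
    (forall p q, pw_cont (fun t => fst (HD t p q)) 0 T /\
                 pw_cont (fun t => snd (HD t p q)) 0 T) /\
    (forall t, 0 <= t <= T -> Rabs (alpha t) <= 1) /\
    (forall x, generated (Hx HD alpha (val x)) T (U x)) /\
    (forall x, U x T = V x) /\
    (forall x, isometry (V x)).

Lemma reachable0 : reachable 0 (fun=> @idmat I).
Proof.
have pw0 f : pw_cont f 0 0 by exists 0%N, (fun=> 0).
exists (fun _ _ _ => C0), (fun=> 0), (fun _ _ => @idmat I).
split; first lra.
split; first by move=> t _ p q; rewrite Conj0.
split; first by [].
split; first by move=> t _; rewrite Rabs_R0; lra.
split; last by split => // x u v; rewrite !mulmv1.
move=> x; split => //; split; last by exists nil => t; lra.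
move=> t _ p q; split=> eps eps0; exists 1; split; try lra;
  move=> s _; by rewrite /= /Rdist Rminus_diag Rabs_R0.
Qed.

(** One more piece with constant Hamiltonian equal to [c] times a projection. It covers both moves
    of the algorithm: a query, with [K = 0] and [a = 1], and an input-independent reflection, with
    [a = 0]. *)
Lemma reachable_step T V tau K a c (P : Xidx X -> mat I) :
  reachable T V -> 0 < tau -> hermitian K -> Rabs a <= 1 ->
  (forall x, projection (P x)) ->
  (forall x p q, Cadd (K p q) (Cscal a (@HQ S n w d (val x) p q)) = Cscal c (P x p q)) ->
  reachable (T + tau) (fun x => mulmm (propagator (P x) (c * tau)) (V x)).
Proof.
move=> [HD [al [U [T0 [hHD [pw [hal [gU [UT isoV]]]]]]]]] tau0 hK ha hP hH.
pose HD' := glue T HD (fun=> K); pose al' := glue T al (fun=> a).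
pose Ur x t := mulmm (propagator (P x) (c * (t - T))) (V x).
exists HD', al', (fun x => glue T (U x) (Ur x)).
have comp (f : Cx -> R) p q : (fun t => f (HD' t p q))
    = glue T (fun t => f (HD t p q)) (fun=> f (K p q)).
  by apply: functional_extensionality => t; rewrite /HD' /glue; case: Rle_dec.
have compU (f : Cx -> R) x p q : (fun t => f (glue T (U x) (Ur x) t p q))
    = glue T (fun t => f (U x t p q)) (fun t => f (Ur x t p q)).
  by apply: functional_extensionality => t; rewrite /glue; case: Rle_dec.
have UrT x : Ur x T = U x T.
  rewrite UT /Ur Rminus_diag Rmult_0_r propagator0; apply: mat_eq => v.
  by rewrite mulmvA mulmv1.
split; first lra.
split.
  move=> t ht; have [tT|tT] := Rle_lt_dec t T.
    by rewrite /HD' glue_le //; apply: hHD; lra.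
  by rewrite /HD' glue_gt.
split.
  move=> p q; rewrite (comp (fun z => fst z)) (comp (fun z => snd z)).
  by have [p1 p2] := pw p q; split; apply: glue_pw_cont.
split.
  move=> t ht; have [tT|tT] := Rle_lt_dec t T.
    by rewrite /al' glue_le //; apply: hal; lra.
  by rewrite /al' glue_gt.
have dUr x t p q :
    derivable_pt_lim (fun s => fst (Ur x s p q)) t
      (fst (Cmul (Copp Ci) (mulmm (fun p q => Cscal c (P x p q)) (Ur x t) p q))) /\
    derivable_pt_lim (fun s => snd (Ur x s p q)) t
      (snd (Cmul (Copp Ci) (mulmm (fun p q => Cscal c (P x p q)) (Ur x t) p q))).
  (* Since [P] is idempotent, applying it to the propagator just multiplies by the phase; this makes
     the closed form solve the Schroedinger equation. *)
  have -> : mulmm (fun p q => Cscal c (P x p q)) (Ur x t) p q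
      = Cmul (c, 0) (Cmul (cexpN (c * (t - T))) (mulmm (P x) (V x) p q)).
    rewrite -mulmm_proj_propagator // -/(Ur x t) -csumZ; apply: eq_csum => k.
    by rewrite CscalE; ring.
  case E : (mulmm (P x) (V x) p q) => [m1 m2].
  split.
    have := derivable_pt_lim_trig (fst (V x p q)) 1 m1 m2 c T t.
    rewrite (_ : (fun s => fst (Ur x s p q)) = fun s => fst (V x p q)
      + (cos (c * (s - T)) - 1) * m1 + sin (c * (s - T)) * m2); last first.
      apply: functional_extensionality => s.
      by rewrite /Ur mulmm_propagator E /=; ring.
    by congr derivable_pt_lim; rewrite /=; ring.
  have := derivable_pt_lim_trig (snd (V x p q)) 1 m2 (- m1) c T t.
  rewrite (_ : (fun s => snd (Ur x s p q)) = fun s => snd (V x p q)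
    + (cos (c * (s - T)) - 1) * m2 + sin (c * (s - T)) * - m1); last first.
    apply: functional_extensionality => s.
    by rewrite /Ur mulmm_propagator E /=; ring.
  by congr derivable_pt_lim; rewrite /=; ring.
split; last first.
  split.
    by move=> x; rewrite glue_gt; [rewrite /Ur; do 3!f_equal; ring | lra].
  move=> x u v; rewrite !mulmvA propagator_isometry //; exact: isoV.
move=> x; have [U0 [cU [bad dU]]] := gU x.
split; first by rewrite glue_le.
split.
  move=> t ht p q; rewrite (compU (fun z => fst z)) (compU (fun z => snd z)).
  split; [have -> : fst (glue T (U x) (Ur x) t p q)
      = glue T (fun t => fst (U x t p q)) (fun t => fst (Ur x t p q)) t
      by rewrite /glue; case: Rle_dec
    | have -> : snd (glue T (U x) (Ur x) t p q)
      = glue T (fun t => snd (U x t p q)) (fun t => snd (Ur x t p q)) t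
      by rewrite /glue; case: Rle_dec];
    apply: glue_limit => //.
  - by move=> s hs; case: (cU s hs p q).
  - by move=> s; apply: derivable_continuous_pt; eexists; exact: (proj1 (dUr x s p q)).
  - by rewrite UrT.
  - by move=> s hs; case: (cU s hs p q).
  - by move=> s; apply: derivable_continuous_pt; eexists; exact: (proj2 (dUr x s p q)).
  - by rewrite UrT.
(* The Hamiltonian may jump at the junction, so [T] joins the exceptional times. *)
exists (T :: bad)%list => t ht tbad p q.
have tT : t <> T by move=> tT; apply: tbad; left.
have tbad' : ~ List.In t bad by move=> h; apply: tbad; right.
rewrite (compU (fun z => fst z)) (compU (fun z => snd z)).
have [tlT|Tlt] : t < T \/ T < t by lra.
  have -> : Hx HD' al' (val x) t = Hx HD al (val x) t.
    by rewrite /Hx /HD' /al' !glue_le //; lra.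
  rewrite (glue_le _ _ (Rlt_le _ _ tlT)).
  have tin : 0 < t < T by lra.
  have [d1 d2] := dU t tin tbad' p q.
  by split; [apply: derivable_pt_lim_near d1 | apply: derivable_pt_lim_near d2];
    (try exact: tin) => s hs; rewrite glue_le //; lra.
have -> : Hx HD' al' (val x) t = fun p q => Cscal c (P x p q).
  apply: functional_extensionality => p'; apply: functional_extensionality => q'.
  by rewrite /Hx /HD' /al' !glue_gt.
rewrite (glue_gt _ _ Tlt).
have tin : T < t < T + tau by lra.
have [d1 d2] := dUr x t p q.
by split; [apply: derivable_pt_lim_near d1 | apply: derivable_pt_lim_near d2];
  (try exact: tin) => s hs; rewrite glue_gt //; lra.
Qed.

End Reachable.

(** * Reflections exchanging two families with equal Gram matrices *)

(** Gram-Schmidt: each new vector is reduced to its component [e] orthogonal to the range so far,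
    and the rank-one projection on [e] is added unless [e] is zero. *)
Lemma span_projection (I : finType) (Y : eqType) (F : Y -> vec I) (s : seq Y) :
  exists P, [/\ projection P, forall y, y \in s -> mulmv P (F y) = F y
    & forall w, (forall y, y \in s -> inner (F y) w = C0) -> mulmv P w = fun=> C0].
Proof.
elim: s => [|y0 s [P [[Ph Pi] Pf Po]]].
  have z v : mulmv (fun _ _ : I => C0) v = fun=> C0.
    by apply: functional_extensionality => i; apply: csum_eq0 => j; ring.
  exists (fun _ _ => C0); split => //; split; first by move=> i j; rewrite Conj0.
  by move=> v; rewrite !z.
set d := F y0; pose e := vsub d (mulmv P d).
have Pe : mulmv P e = fun=> C0.
  rewrite mulmvB Pi; apply: functional_extensionality => i; rewrite /vsub; ring.
have inner0 u : inner u (fun=> C0) = C0 by apply: csum_eq0 => i; ring.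
have inner0l u : inner (fun=> C0) u = C0 by rewrite inner_conj inner0 Conj0.
have eP v : inner e (mulmv P v) = C0 by rewrite inner_hermitian // Pe inner0l.
have dE : d = vadd (mulmv P d) e.
  by apply: functional_extensionality => i; rewrite /vadd /e /vsub; ring.
have [e0|e0] : norm2 e = 0 \/ 0 < norm2 e by have := norm2_ge0 e; lra.
  exists P; split => //.
    move=> y; rewrite inE => /orP [/eqP ->|]; last exact: Pf.
    rewrite -/d {2}dE (norm2_eq0 e0); apply: functional_extensionality => i.
    by rewrite /vadd; ring.
  by move=> w ow; apply: Po => y ys; apply: ow; rewrite inE ys orbT.
pose P' : mat I := fun i j => Cadd (P i j) (Cscal (/ norm2 e) (Cmul (e i) (Cconj (e j)))).
have P'E v : mulmv P' v = vadd (mulmv P v) (vscal (Cscal (/ norm2 e) (inner e v)) e).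
  apply: functional_extensionality => i; rewrite /vadd /vscal CscalE.
  rewrite (_ : Cmul _ (e i) = Cmul (Cmul (/ norm2 e, 0) (e i)) (inner e v)); last by ring.
  rewrite /inner -csumZ /mulmv -csumD; apply: eq_csum => j.
  by rewrite /P' CscalE; ring.
have ee : Cscal (/ norm2 e) (inner e e) = C1 by rewrite inner_self; cx; lra.
have z0 : Cscal (/ norm2 e) C0 = C0 by cx.
exists P'; split.
- split.
    by move=> i j; rewrite /P' (Ph i j) !CscalE !(ConjD, ConjM, ConjK, Conj_real); ring.
  move=> v; rewrite !P'E mulmvD mulmvZ Pi Pe innerDr innerZr eP.
  rewrite (_ : Cscal _ (Cadd _ _) = Cmul (Cscal (/ norm2 e) (inner e v))
    (Cscal (/ norm2 e) (inner e e))); last by rewrite !CscalE; ring.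
  rewrite ee; apply: functional_extensionality => i; rewrite /vadd /vscal; ring.
- move=> y; rewrite inE => /orP [/eqP ->|ys].
    rewrite -/d P'E {2}dE innerDr eP (_ : Cadd C0 (inner e e) = inner e e); last by ring.
    rewrite ee {2}dE; apply: functional_extensionality => i.
    by rewrite /vadd /vscal; ring.
  rewrite P'E -(Pf _ ys) eP z0 Pi; apply: functional_extensionality => i.
  by rewrite /vadd /vscal; ring.
- move=> w ow; have Pw : mulmv P w = fun=> C0.
    by apply: Po => y ys; apply: ow; rewrite inE ys orbT.
  rewrite P'E Pw innerBl ow ?inE ?eqxx // -inner_hermitian // Pw inner0.
  by apply: functional_extensionality => i; rewrite /vadd /vscal !CscalE; ring.
Qed.

(** Let [P] project on the span of the differences [p x - q x]. The two hypotheses say that every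
    sum [p x + q x] is orthogonal to that span, so the reflection [I - 2 P], the propagator at angle
    [PI], negates the differences, fixes the sums, and so swaps [p x] and [q x]. *)
Lemma reflection_exchange (I Y : finType) (p q : Y -> vec I) :
  (forall x y, inner (p x) (p y) = inner (q x) (q y)) ->
  (forall x y, inner (p x) (q y) = inner (q x) (p y)) ->
  exists P, projection P /\ forall x, mulmv (propagator P PI) (p x) = q x.
Proof.
move=> gram cross.
have [P [Pp Pf Po]] := @span_projection I Y (fun x => vsub (p x) (q x)) (enum Y).
exists P; split => // x; rewrite mulmv_propagator.
have h1 := Pf x (mem_enum Y x).
have h2 : mulmv P (vadd (p x) (q x)) = fun=> C0.
  apply: Po => y _; rewrite innerBl !innerDr gram -cross; ring.
rewrite mulmvB in h1; rewrite mulmvD in h2.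
apply: functional_extensionality => i.
move/(f_equal (fun f => f i)): h1; move/(f_equal (fun f => f i)): h2.
rewrite /vadd /vsub /vscal /cexpN cos_PI sin_PI.
move: (p x i) (q x i) (mulmv P (p x) i) (mulmv P (q x) i) => [a1 a2] [b1 b2] [c1 c2] [d1 d2].
move=> [h1 h2] [h3 h4]; cx.
Qed.

(** Isometry and the orthogonality conditions give the overlap exactly as [1 - g] plus the inner
    product of [c1] with [V c0], whose real part is at least [- g]. The loss is thus quadratic in
    the length of the catalyst. *)
Lemma overlap_bound (I : finType) (V : mat I) (psi phi c0 c1 : vec I) (g : R) :
  isometry V -> mulmv V (vadd psi c0) = vadd phi c1 ->
  norm2 phi = 1 -> inner psi c0 = C0 -> inner phi c1 = C0 ->
  norm2 c0 = g -> norm2 c1 = g ->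
  1 - 2 * g <= fst (inner phi (mulmv V psi)).
Proof.
move=> iV Vp phi1 pc0 pc1 n0 n1.
have nV : norm2 (mulmv V c0) = g.
  by have := iV c0 c0; rewrite !inner_self n0 => -[].
have := Re_inner_ge c1 (mulmv V c0); rewrite n1 nV.
have := iV (vadd psi c0) c0; rewrite Vp innerDl innerDl pc0 inner_self n0.
have : inner phi (mulmv V (vadd psi c0)) = C1.
  by rewrite Vp innerDr pc1 inner_self phi1; cx.
rewrite mulmvD innerDr.
move: (inner phi (mulmv V psi)) (inner phi (mulmv V c0)) (inner c1 (mulmv V c0)).
move=> [a1 a2] [b1 b2] [d1 d2] [/= h1 h2] [h3 h4]; lra.
Qed.

(** * The oracle *)

Section Oracle.
Variables (S : finType) (n w d : nat).
Notation I := (Idx S n w d).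
Notation HQ := (@HQ S n w d).

Lemma inv_sqrt2_sqr : / sqrt 2 * / sqrt 2 = 1 / 2.
Proof. by rewrite -Rinv_mult sqrt_sqrt; lra. Qed.

Lemma csum_Idx (F : I -> Cx) :
  csum F = Cadd (csum (fun j => csum (fun a => csum (fun k => F (inl (j, a, k))))))
                (csum (fun k => F (inr k))).
Proof.
rewrite csum_sum; congr Cadd; rewrite !csum_pair.
by apply: eq_csum => j; apply: eq_csum.
Qed.

Lemma mulmv_HQ (x : n.-tuple S) (v : vec I) j a k :
  mulmv (HQ x) v (inl (j, a, k)) =
  Cmul (ycoef (tnth x j) a, 0)
    (csum (fun b => Cmul (ycoef (tnth x j) b, 0) (v (inl (j, b, k))))).
Proof.
rewrite /mulmv csum_Idx [X in Cadd _ X]csum_eq0; last by move=> i; rewrite /=; ring.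
rewrite (_ : Cadd _ C0 = csum (fun j' => if j' == j then csum (fun b =>
   csum (fun k' => if k' == k then Cmul (hmat (tnth x j') a b) (v (inl (j', b, k'))) else C0))
   else C0)); last first.
  rewrite (_ : forall z, Cadd z C0 = z); last by move=> z; ring.
  apply: eq_csum => j'; rewrite /= [in RHS]eq_sym; case: eqP => [->|_] /=.
    apply: eq_csum => b; apply: eq_csum => k'; rewrite [in RHS]eq_sym.
    by case: eqP => _ //; ring.
  by apply: csum_eq0 => b; apply: csum_eq0 => k'; ring.
rewrite csum_delta -csumZ; apply: eq_csum => b; rewrite csum_delta /hmat.
by cx.
Qed.

Lemma mulmv_HQ_inr (x : n.-tuple S) (v : vec I) k : mulmv (HQ x) v (inr k) = C0.
Proof. by apply: csum_eq0 => i; rewrite /=; ring. Qed.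

Lemma csum_ycoef (y : S) (f : option S -> Cx) :
  csum (fun b => Cmul (ycoef y b, 0) (f b)) = Cmul (/ sqrt 2, 0) (Csub (f None) (f (Some y))).
Proof.
rewrite csum_option /=.
rewrite (_ : csum _ = csum (fun z => if z == y then Cmul (- / sqrt 2, 0) (f (Some z)) else C0)).
  by rewrite csum_delta; cx.
by apply: eq_csum => z; case: (z == y) => //; cx.
Qed.

Lemma HQ_projection (x : n.-tuple S) : projection (HQ x).
Proof.
split.
  case=> [[[j a] k]|k] [[[j' a'] k']|k'] //=; rewrite ?Conj0 //.
  rewrite (eq_sym j') (eq_sym k'); case: eqP => [->|_] /=; last by rewrite Conj0.
  by case: eqP => _; rewrite ?Conj0 // /hmat; cx.
move=> v; apply: functional_extensionality => -[[[j a] k]|k]; last by rewrite !mulmv_HQ_inr.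
rewrite !mulmv_HQ !csum_ycoef !mulmv_HQ !csum_ycoef /= eqxx.
move: (Csub (v _) (v _)) => z; move: inv_sqrt2_sqr => h.
rewrite (_ : Csub _ _ = Cmul (/ sqrt 2 * / sqrt 2 + / sqrt 2 * / sqrt 2, 0) z); last by cx.
have -> : (/ sqrt 2 * / sqrt 2 + / sqrt 2 * / sqrt 2, 0) = C1 by rewrite h /C1; congr pair; lra.
by ring.
Qed.

End Oracle.

(** * The conversion algorithm *)

Section Algorithm.
Variables (S : finType) (n : nat) (A B : finType).
Variable jl : A -> 'I_n.
Notation I := (Idx S n #|{: A * bool}| #|B|).

(* coordinates of [al |y^+> + be |y^->] *)
Definition site (y : S) (al be : Cx) (a : option S) : Cx :=
  match a with
  | None => Cmul (/ sqrt 2, 0) (Cadd al be)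
  | Some z => if z == y then Cmul (/ sqrt 2, 0) (Csub al be) else C0
  end.

(* [f] in the summand H', and the catalyst sum_l |jl l> |site l> |l, b> *)
Definition state (x : n.-tuple S) (al be : A -> Cx) (b : bool) (f : vec B) : vec I :=
  fun i => match i with
  | inl (j, a, k) =>
      let: (l, b') := enum_val k in
      if (b' == b) && (j == jl l) then site (tnth x j) (al l) (be l) a else C0
  | inr k => f (enum_val k)
  end.

Lemma stateD x al be al' be' b f f' :
  state x (fun l => Cadd (al l) (al' l)) (fun l => Cadd (be l) (be' l)) b (vadd f f')
  = vadd (state x al be b f) (state x al' be' b f').
Proof.
apply: functional_extensionality => -[[[j a] k]|k] //; rewrite /vadd /=.
case: (enum_val k) => l b'; case: ifP => _; last by ring.
by case: a => [z|] /=; [case: (z == _)|]; ring.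
Qed.

Lemma propagator_state x al be b f tau :
  mulmv (propagator (@HQ S n #|{: A * bool}| #|B| x) tau) (state x al be b f)
  = state x al (fun l => Cmul (cexpN tau) (be l)) b f.
Proof.
rewrite mulmv_propagator; apply: functional_extensionality => -[[[j a] k]|k];
  rewrite /vadd /vscal; last by rewrite mulmv_HQ_inr /=; ring.
rewrite mulmv_HQ csum_ycoef /=; case: (enum_val k) => l b'.
case: ifP => _; last by ring.
rewrite /= eqxx.
rewrite (_ : Cmul (/ sqrt 2, 0) (Csub _ _)
  = Cmul (/ sqrt 2 * / sqrt 2 + / sqrt 2 * / sqrt 2, 0) (be l)); last by cx.
have -> : (/ sqrt 2 * / sqrt 2 + / sqrt 2 * / sqrt 2, 0) = C1.
  by rewrite inv_sqrt2_sqr /C1; congr pair; lra.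
case: a => [z|] /=; last by ring.
by case: (z == _); cx.
Qed.

(** Two sites always overlap in the [None] component, but in the other component only when the
    symbols agree; this is how the oracle sees whether two inputs differ. *)
Definition site_inner (y y' : S) (al be al' be' : Cx) : Cx :=
  Cmul (1 / 2, 0) (Cadd (Cmul (Cconj (Cadd al be)) (Cadd al' be'))
    (if y == y' then Cmul (Cconj (Csub al be)) (Csub al' be') else C0)).

Lemma inner_site y y' al be al' be' :
  csum (fun a => Cmul (Cconj (site y al be a)) (site y' al' be' a))
  = site_inner y y' al be al' be'.
Proof.
rewrite csum_option /=.
rewrite (_ : csum _ = csum (fun z => if z == y then (if y == y' then
  Cmul (/ sqrt 2 * / sqrt 2, 0) (Cmul (Cconj (Csub al be)) (Csub al' be')) else C0) else C0)).
  rewrite csum_delta /site_inner ConjM Conj_real.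
  rewrite (_ : Cmul (Cmul _ _) _ = Cmul (/ sqrt 2 * / sqrt 2, 0)
    (Cmul (Cconj (Cadd al be)) (Cadd al' be'))); last by cx.
  by rewrite inv_sqrt2_sqr; case: (y == y'); ring.
apply: eq_csum => z; have [->|_] := eqVneq z y; last by rewrite Conj0; ring.
by case: (y == y'); [cx | ring].
Qed.

Lemma inner_state x y al be al' be' b b' f f' :
  inner (state x al be b f) (state y al' be' b' f') =
  Cadd (if b == b' then csum (fun l => site_inner (tnth x (jl l)) (tnth y (jl l))
                                  (al l) (be l) (al' l) (be' l)) else C0)
       (inner f f').
Proof.
rewrite /inner csum_Idx; congr Cadd; last first.
  exact: (csum_ord_enum (fun i => Cmul (Cconj (f i)) (f' i))).
pose F j a (lc : A * bool) := if (lc.2 == b) && (lc.2 == b') && (j == jl lc.1) then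
  Cmul (Cconj (site (tnth x j) (al lc.1) (be lc.1) a))
       (site (tnth y j) (al' lc.1) (be' lc.1) a) else C0.
transitivity (csum (fun j => csum (fun a => csum (fun lc => F j a lc)))).
  apply: eq_csum => j; apply: eq_csum => a; rewrite -[RHS](csum_ord_enum (F j a)).
  apply: eq_csum => k; rewrite /F /=; case: (enum_val k) => l c /=.
  by case: (c == b); case: (c == b'); case: (j == jl l); rewrite /= ?Conj0; ring.
transitivity (csum (fun j => csum (fun lc => csum (fun a => F j a lc)))).
  by apply: eq_csum => j; exact: csum_exchange.
rewrite csum_exchange csum_pair.
have FE l c : csum (fun j => csum (fun a => F j a (l, c))) =
    if (c == b) && (c == b') then site_inner (tnth x (jl l)) (tnth y (jl l))
      (al l) (be l) (al' l) (be' l) else C0.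
  rewrite /F /=; case: andP => [_|_] /=; last first.
    by apply: csum_eq0 => j; apply: csum_eq0.
  rewrite -inner_site -[RHS](csum_delta (jl l) (fun j => csum (fun a =>
    Cmul (Cconj (site (tnth x j) (al l) (be l) a)) (site (tnth y j) (al' l) (be' l) a)))).
  by apply: eq_csum => j; case: (j == jl l) => //; apply: csum_eq0.
rewrite (_ : csum _ = csum (fun l => if b == b' then site_inner (tnth x (jl l))
  (tnth y (jl l)) (al l) (be l) (al' l) (be' l) else C0)).
  by case: (b == b') => //; apply: csum_eq0.
apply: eq_csum => l; rewrite csum_bool !FE.
by case: (b); case: (b') => /=; ring.
Qed.

End Algorithm.

(** The squared chord is [2 - 2 * cos tau], and the fourth-order Taylor bound on the cosine keeps it
    above a quarter of [tau * tau] on this range. *)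
Lemma chord_lower (tau : R) : 0 < tau <= 1 -> tau / 2 <= sqrt (Cnorm2 (Csub (cexpN tau) C1)).
Proof.
move=> [t0 t1].
have h1 : - PI / 2 <= tau by have := PI2_1; lra.
have h2 : tau <= PI / 2 by have := PI2_1; lra.
have [_] := cos_bound tau 0 h1 h2.
rewrite /cos_approx /= /cos_term /= => h.
have cb : cos tau <= 1 - tau * tau / 2 + tau * tau * (tau * tau) / 24.
  by apply: Rle_trans h _; lra.
rewrite -[tau / 2]sqrt_square; last lra.
apply: sqrt_le_1_alt; rewrite /Cnorm2 /cexpN /=.
have := sin2_cos2 tau; rewrite /Rsqr => sc.
have t2 : 0 <= tau * tau <= 1 by nra.
have tt : tau * tau * (tau * tau) <= tau * tau * 1 by apply: Rmult_le_compat_l; lra.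
lra.
Qed.

(** * Rounds of one query and one reflection *)

Section Conversion.
Variables (S : finType) (n : nat) (X : {set n.-tuple S}) (A : finType).
Variables (jl : A -> 'I_n) (u v : A -> vec (Xidx X)).
Variables (rho sigma : mat (Xidx X)) (m1 m2 : nat).
Variables (r : Xidx X -> vec 'I_m1) (s : Xidx X -> vec 'I_m2).
Hypothesis rE : forall x y, rho x y = inner (r x) (r y).
Hypothesis sE : forall x y, sigma x y = inner (s x) (s y).
Hypothesis dualE : forall x y,
  dual_mat (@differ S n X) jl u v x y = msub rho sigma x y.

Notation B := ('I_m1 + 'I_m2)%type.
Notation I := (Idx S n #|{: A * bool}| #|{: B}|).

Definition emb (a b : R) (x : Xidx X) : vec B :=
  fun i => match i with inl i => Cmul (a, 0) (r x i) | inr i => Cmul (b, 0) (s x i) end.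

Lemma inner_emb a b a' b' x y : inner (emb a b x) (emb a' b' y)
  = Cadd (Cmul (a * a', 0) (rho x y)) (Cmul (b * b', 0) (sigma x y)).
Proof.
rewrite rE sE /inner csum_sum /= -!csumZ.
by congr Cadd; apply: eq_csum => i; rewrite ConjM Conj_real; cx.
Qed.

Variables (N : nat) (tau : R).
Hypothesis N0 : (0 < N)%N.
Hypothesis tau01 : 0 < tau <= 1.

Let z := cexpN tau.
Let q := sqrt (Cnorm2 (Csub z C1)).
(** The amplitude of the catalyst, scaled so that [kap * kap * q = / INR N]: one query then moves
    the Gram matrix by a fraction [1 / N]. *)
Let kap := sqrt (/ (INR N * q)).
(* the phase for which [(z - 1) * mu] is the negative real number [- q] *)
Let mu := Cmul (- / q, 0) (Cconj (Csub z C1)).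

Let al x l := Cmul (kap, 0) (v l x).
Let be x l := Cmul (kap, 0) (Cmul mu (u l x)).

Lemma q_gt0 : 0 < q.
Proof. by have := chord_lower tau01; rewrite -/z -/q; lra. Qed.

Lemma N_gt0 : 0 < INR N.
Proof. by apply: lt_0_INR; apply/ltP. Qed.

Lemma q_sqr : q * q = Cnorm2 (Csub z C1).
Proof. by rewrite sqrt_sqrt //; exact: Cnorm2_ge0. Qed.

Lemma kap_sqr : kap * kap = / (INR N * q).
Proof.
have h := Rmult_lt_0_compat _ _ N_gt0 q_gt0.
by rewrite sqrt_sqrt //; have := Rinv_0_lt_compat _ h; lra.
Qed.

Lemma mu_chord : Cmul (Csub z C1) mu = (- q, 0).
Proof.
have q0 := q_gt0; rewrite /mu.
rewrite (_ : Cmul _ _ = Cmul (- / q, 0) (Cmul (Cconj (Csub z C1)) (Csub z C1))); last by ring.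
by rewrite Cconj_mulE -q_sqr; apply: Cx_eq; rewrite /=; field; lra.
Qed.

Lemma mu_norm : Cnorm2 mu = 1.
Proof.
have q0 := q_gt0; rewrite /mu Cnorm2M Cnorm2_conj -q_sqr /Cnorm2 /=.
by field; lra.
Qed.

Definition catgram (zz : Cx) (x y : Xidx X) : Cx :=
  csum (fun l => site_inner (tnth (val x) (jl l)) (tnth (val y) (jl l))
    (al x l) (Cmul zz (be x l)) (al y l) (Cmul zz (be y l))).

(** Where two inputs agree, only the products [v v] and [u u] survive, and the phase cancels. Where
    they differ, the cross terms between [v] and [u] remain and change by [(z - 1) * mu = - q],
    which reproduces [dual_mat] with the real factor [- kap * kap * q]. *)
Lemma catgram_query x y :
  catgram z x y = Cadd (catgram C1 x y) (Cmul (- / INR N, 0) (msub rho sigma x y)).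
Proof.
rewrite -dualE /catgram /dual_mat -csumZ -csumD; apply: eq_csum => l.
have zz : Cmul (Cconj z) z = C1 by exact: cexpN_norm.
have k2 : Cmul (kap, 0) (kap, 0) = (/ (INR N * q), 0).
  by rewrite -kap_sqr; cx.
have qN : Cmul (/ (INR N * q), 0) (- q, 0) = (- / INR N, 0).
  by have := q_gt0; have := N_gt0 => *; apply: Cx_eq; rewrite /=; field; lra.
have mc := mu_chord.
have mc' : Cmul (Cconj (Csub z C1)) (Cconj mu) = (- q, 0).
  by rewrite -ConjM mc Conj_real.
rewrite -qN -k2 /site_inner /differ /al /be {qN k2}.
move: zz mc mc'; move: (mu) (kap) (q) (z) => m k c e ee mc mc'.
set vx := v l x; set vy := v l y; set ux := u l x; set uy := u l y.
rewrite ConjB Conj1 in mc'.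
case: eqP => _ /=.
  rewrite !(ConjD, ConjB, ConjM, Conj_real, Conj1).
  transitivity (Cmul (Cadd (1 / 2, 0) (1 / 2, 0)) (Cmul (Cmul (k, 0) (k, 0))
    (Cadd (Cmul (Cconj vx) vy) (Cmul (Cmul (Cconj e) e)
      (Cmul (Cmul (Cconj m) m) (Cmul (Cconj ux) uy)))))).
    by ring.
  by rewrite ee; ring.
rewrite !(ConjD, ConjB, ConjM, Conj_real, Conj1) CscalE.
transitivity (Cmul (1 / 2, 0) (Cmul (Cmul (k, 0) (k, 0))
  (Cadd (Cmul (Cconj vx) vy) (Cadd (Cmul (Cmul (Cconj e) e)
      (Cmul (Cmul (Cconj m) m) (Cmul (Cconj ux) uy)))
   (Cadd (Cadd (Cmul (Cmul (Csub e C1) m) (Cmul (Cconj vx) uy))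
         (Cmul (Cmul (Csub (Cconj e) C1) (Cconj m)) (Cmul (Cconj ux) vy)))
     (Cadd (Cmul m (Cmul (Cconj vx) uy)) (Cmul (Cconj m) (Cmul (Cconj ux) vy)))))))).
  by ring.
by rewrite ee mc mc'; ring.
Qed.

(** [zz] is [C1] before a query and [z] after it. The flag [odd k] places the catalysts of
    consecutive stages in orthogonal registers. *)
Definition stage (k : nat) (zz : Cx) (x : Xidx X) : vec I :=
  state jl (val x) (al x) (fun l => Cmul zz (be x l)) (odd k)
    (emb (sqrt (1 - INR k / INR N)) (sqrt (INR k / INR N)) x).

(** Moving weight [1 / N] from [rho] to [sigma] changes the Gram matrix by exactly what the query
    changed in the catalyst. *)
Lemma stage_gram k x y : (k < N)%N ->
  inner (stage k z x) (stage k z y) = inner (stage k.+1 C1 x) (stage k.+1 C1 y).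
Proof.
move=> kN; rewrite /stage !inner_state !eqxx -/(catgram z x y) -/(catgram C1 x y).
rewrite catgram_query !inner_emb.
have N0' := N_gt0.
have frac i : (i <= N)%N -> 0 <= INR i / INR N <= 1.
  move=> iN; have i0 := pos_INR i.
  have iN' : INR i <= INR N by apply: le_INR; apply/leP.
  have iE : INR i / INR N * INR N = INR i by field; lra.
  split; apply: (Rmult_le_reg_r (INR N)) => //; rewrite iE; lra.
have := frac k (ltnW kN); have := frac k.+1 kN => f1 f2.
rewrite !sqrt_sqrt; try lra.
rewrite S_INR /msub; apply: Cx_eq; rewrite /=; field; lra.
Qed.

(** The parity flag removes the catalysts from the cross terms; what remains is a real combination
    of [rho] and [sigma], symmetric in the two stages. *)
Lemma stage_cross k x y :
  inner (stage k z x) (stage k.+1 C1 y) = inner (stage k.+1 C1 x) (stage k z y).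
Proof.
have odds : (odd k == odd k.+1) = false by rewrite /=; case: (odd k).
rewrite /stage !inner_state odds eq_sym odds !inner_emb.
by apply: Cx_eq; rewrite /=; ring.
Qed.

Lemma reach_stage (del : R) (k : nat) : 0 < del -> (k <= N)%N ->
  exists V : Xidx X -> mat I, reachable (INR k * (tau + del)) V /\
    forall x, mulmv (V x) (stage 0 C1 x) = stage k C1 x.
Proof.
move=> del0; elim: k => [|k IH] kN.
  exists (fun=> @idmat I); split; last by move=> x; rewrite mulmv1.
  by rewrite Rmult_0_l; exact: reachable0.
have [V [rV Vs]] := IH (ltnW kN).
have [P [Pp Ps]] := @reflection_exchange I (Xidx X) (stage k z) (stage k.+1 C1)
  (fun x y => stage_gram x y kN) (stage_cross k).
have r1 : reachable (INR k * (tau + del) + tau)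
    (fun x => mulmm (propagator (@HQ S n #|{: A * bool}| #|{: B}| (val x)) (1 * tau)) (V x)).
  apply: (@reachable_step _ _ _ _ _ _ _ tau (fun _ _ => C0) 1 1 _ rV); first lra.
  - by move=> i j; rewrite Conj0.
  - by rewrite Rabs_R1; lra.
  - by move=> x; exact: HQ_projection.
  - by move=> x i j; rewrite !CscalE; ring.
have Ph := proj1 Pp.
(* The driver strength is unconstrained, so [PI / del] completes the reflection in time [del]. *)
have r2 := @reachable_step _ _ _ _ _ _ _ del (fun i j => Cscal (PI / del) (P i j))
  0 (PI / del) (fun=> P) r1 del0.
exists (fun x => mulmm (propagator P (PI / del * del))
  (mulmm (propagator (@HQ S n #|{: A * bool}| #|{: B}| (val x)) (1 * tau)) (V x))).
split.
  rewrite (_ : INR k.+1 * (tau + del) = INR k * (tau + del) + tau + del);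
    last by rewrite S_INR; ring.
  apply: r2 => //.
  - by move=> i j; rewrite (Ph i j) !CscalE ConjM Conj_real.
  - by rewrite Rabs_R0; lra.
  - by move=> x i j; rewrite !CscalE; cx.
move=> x; rewrite !mulmvA Vs (_ : PI / del * del = PI); last by field; lra.
rewrite -Ps; congr mulmv; rewrite /stage propagator_state Rmult_1_l -/z.
by congr state; apply: functional_extensionality => l; ring.
Qed.

(** The phase [mu] has modulus one, and the two components of a site are orthogonal, so only the
    squared lengths of [u] and [v] enter. *)
Lemma catalyst_norm x b :
  norm2 (state jl (val x) (al x) (be x) b (fun _ : B => C0))
  = 2 * (kap * kap) * dual_weight u v x.
Proof.
have := inner_self (state jl (val x) (al x) (be x) b (fun _ : B => C0)).
move/(f_equal (fun c : Cx => fst c)) => /= <-.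
rewrite inner_state eqxx (_ : inner (fun=> C0) _ = C0); last by apply: csum_eq0 => i; ring.
rewrite /= Rplus_0_r fst_csum /dual_weight -rsumZ; apply: eq_rsum => l.
have nb : Cnorm2 (be x l) = kap * kap * Cnorm2 (u l x).
  by rewrite /be (Cnorm2M (kap, 0)) (Cnorm2M mu) mu_norm /Cnorm2 /=; ring.
have na : Cnorm2 (al x l) = kap * kap * Cnorm2 (v l x).
  by rewrite /al (Cnorm2M (kap, 0)) /Cnorm2 /=; ring.
rewrite (_ : 2 * _ * _ = Cnorm2 (al x l) + Cnorm2 (be x l)); last by rewrite na nb; field.
rewrite /site_inner eqxx; move: (al x l) (be x l) => [a1 a2] [b1 b2].
by rewrite /Cnorm2 /=; field.
Qed.

Lemma conversion (W eps del : R) :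
  unit_gram sigma -> 0 < del -> 0 < eps < 1 -> 0 <= W ->
  (forall x, dual_weight u v x <= W) -> 16 * W <= eps * (INR N * tau) ->
  ct_converts rho sigma eps (INR N * (tau + del)).
Proof.
move=> us del0 eps01 W0 dW WN.
have [V [[HD [alpha [U [T0 [hHD [pw [hal [gU [UT isoV]]]]]]]]] Vs]] :=
  reach_stage del0 (leqnn N).
pose zero (_ : A) := C0.
pose psi x : vec I := state jl (val x) zero zero false (emb 1 0 x).
pose phi x : vec I := state jl (val x) zero zero (odd N) (emb 0 1 x).
pose cat x b : vec I := state jl (val x) (al x) (be x) b (fun=> C0).
have site0 y y' a b : site_inner y y' C0 C0 a b = C0.
  by rewrite /site_inner; case: (y == y'); cx.
have inn x y b a e c (f g : vec B) : inner (state jl (val x) zero zero b f)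
    (state jl (val y) a e c g) = inner f g.
  rewrite inner_state (_ : csum _ = C0); last by apply: csum_eq0 => l.
  by case: (b == c); ring.
have f0 (f : vec B) : inner f (fun=> C0) = C0 by apply: csum_eq0 => i; ring.
have N0' := N_gt0.
have s0 x : stage 0 C1 x = vadd (psi x) (cat x false).
  rewrite /psi /cat -stateD /stage /= /zero; congr state.
  - by apply: functional_extensionality => l; ring.
  - by apply: functional_extensionality => l; ring.
  - have -> : 0 / INR N = 0 by field; lra.
    rewrite Rminus_0_r sqrt_0 sqrt_1; apply: functional_extensionality => i.
    by rewrite /vadd; ring.
have sN x : stage N C1 x = vadd (phi x) (cat x (odd N)).
  rewrite /phi /cat -stateD /stage /= /zero; congr state.
  - by apply: functional_extensionality => l; ring.
  - by apply: functional_extensionality => l; ring.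
  - have -> : INR N / INR N = 1 by field; lra.
    rewrite Rminus_diag sqrt_0 sqrt_1; apply: functional_extensionality => i.
    by rewrite /vadd; ring.
exists #|{: A * bool}|, #|{: B}|, HD, alpha, U, psi, phi.
do 5!split => //.
split.
  move=> x y; rewrite /psi /phi !inn !inner_emb.
  by split; apply: Cx_eq; rewrite /=; ring.
move=> x; rewrite UT.
have ov := @overlap_bound I (V x) (psi x) (phi x) (cat x false) (cat x (odd N))
  (2 * (kap * kap) * dual_weight u v x) (isoV x).
apply: Rle_trans (ov _ _ _ _ _ _).
- have q0 := chord_lower tau01; rewrite -/z -/q in q0.
  have qp := q_gt0.
  (* The loss is twice the squared norm of the catalyst, hence the [4]. With [q >= tau / 2] it is at
     most [8 * W / (INR N * tau)], so the factor [16] in the hypothesis gives [eps / 2], enough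
     because [sqrt (1 - eps) <= 1 - eps / 2]. *)
  have kW : 4 * (kap * kap) * W <= eps / 2.
    rewrite kap_sqr; apply: (Rmult_le_reg_r (INR N * q)); first exact: Rmult_lt_0_compat.
    rewrite (_ : 4 * / (INR N * q) * W * (INR N * q) = 4 * W); last by field; lra.
    have : INR N * (tau / 2) <= INR N * q by apply: Rmult_le_compat_l; lra.
    move=> h; have : eps * (INR N * (tau / 2)) <= eps * (INR N * q).
      by apply: Rmult_le_compat_l; lra.
    lra.
  have kx : kap * kap * dual_weight u v x <= kap * kap * W.
    by apply: Rmult_le_compat_l => //; nra.
  have : sqrt (1 - eps) <= 1 - eps / 2.
    rewrite -[1 - eps / 2]sqrt_square; last lra.
    by apply: sqrt_le_1_alt; nra.
  lra.
- by rewrite -s0 Vs sN.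
- have := inner_self (phi x); rewrite /phi inn inner_emb (unit_gram_diag x us).
  by move/(f_equal (fun c : Cx => fst c)) => /= <-; ring.
- by rewrite /psi inn f0.
- by rewrite /phi inn f0.
- exact: catalyst_norm.
- exact: catalyst_norm.
Qed.

End Conversion.

(* Q^ct_eps(rho,sigma) <= C * Adv*(rho,sigma) / eps, with the infimum unfolded:
   for every delta > 0 there is an algorithm of duration <= C*Adv*/eps + delta. *)
Theorem theorem4p1 :
  exists C : R, 0 < C /\
    forall (S : finType) (n : nat) (X : {set n.-tuple S})
           (rho sigma : mat (Xidx X)) (eps adv : R),
      (1 <= n)%nat ->
      unit_gram rho -> unit_gram sigma ->
      0 < eps < 1 ->
      is_Adv rho sigma adv ->
      forall delta : R, 0 < delta ->
        exists T : R, ct_converts rho sigma eps T /\ T <= C * adv / eps + delta.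
Proof.
exists 16; split; first lra.
move=> S n X rho sigma eps adv n0 ur us eps01 hadv del del0.
have [adv0 dual] := Adv_dual n0 ur us hadv.
(* The slack in the dual weights costs time [16 * del1 / eps], which is [del / 2]; the reflections
   take the other half. *)
pose del1 := del * eps / 32.
have del1p : 0 < del1 by rewrite /del1; nra.
have [A [jl [u [v [dE dW]]]]] := dual _ del1p.
have [m1 [r [_ rE]]] := ur; have [m2 [s [_ sE]]] := us.
pose T0 := 16 * (adv + del1) / eps.
have T0p : 0 < T0 by apply: Rdiv_lt_0_compat; lra.
(* The total query time [T0] is fixed in advance; it is cut into enough rounds that each query lasts
   at most [1], the range of the chord estimate. *)
have [N0 hN0] := INR_unbounded T0.
have N0p : (0 < N0)%N by case: N0 hN0 => //= h; lra.
have Np : 0 < INR N0 by lra.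
have tau01 : 0 < T0 / INR N0 <= 1.
  split; first exact: Rdiv_lt_0_compat.
  apply: (Rmult_le_reg_r (INR N0)) => //.
  rewrite (_ : T0 / INR N0 * INR N0 = T0); last by field; lra.
  lra.
have NT : INR N0 * (T0 / INR N0) = T0 by field; lra.
have del2 : 0 < del / 2 / INR N0 by apply: Rdiv_lt_0_compat; lra.
exists (INR N0 * (T0 / INR N0 + del / 2 / INR N0)); split.
  apply: (@conversion S n X A jl u v rho sigma m1 m2 r s rE sE dE N0 _ N0p tau01
    (adv + del1)) => //; first lra.
  by rewrite NT /T0; right; field; lra.
rewrite Rmult_plus_distr_l NT.
have -> : INR N0 * (del / 2 / INR N0) = del / 2 by field; lra.
by rewrite /T0 /del1; right; field; lra.
Qed.
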